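(* Let $A$ be an $\omega^\phi$-Archimedean initial subfield of $\mathbf{No}$. Then $K$ is an initial convex subdomain of $A$ if and only if $K=A[\omega^\tau]$ for some multiplicatively indecomposable ordinal $\omega^\tau\le\omega^\phi$.
   Context: The underlying set theory is NBG with global choice; structures may have proper-class universes. Subdomains contain $1$. $\mathbf{No}$ is Conway's ordered field of surreal numbers, with its tree structure: a surreal number is identified with a sequence of signs $-,+$ indexed by an ordinal; $x<_s y$ (''$x$ is simpler than $y$'', ''$x$ is a predecessor of $y$'') means that $x$ is a proper initial segment of $y$; and $<$ is the lexicographic order determined by $-<\text{undefined}<+$. Addition and multiplication are Conway's. A subclass $A\subseteq\mathbf{No}$ is initial if $x\in A$ and $y<_s x$ imply $y\in A$; an initial subfield (subdomain) is a subfield (subdomain) that is initial. The class $\mathbf{On}$ of ordinals is identified with the class of surreals all of whose signs are $+$. For a nontrivial initial additive subgroup $A$ of $\mathbf{No}$, $\mathbf{On}(A)=\mathbf{On}\cap A$ is an initial segment of $\mathbf{On}$, and $A$ is called $\alpha$-Archimedean if $\alpha$ is the height of the tree $\mathbf{On}(A)$, i.e. $\mathbf{On}(A)=\{\beta\in\mathbf{On}:\beta<\alpha\}$; here $\alpha=\mathbf{On}$ is allowed, with the convention $\omega^{\mathbf{On}}=\mathbf{On}$, which also counts as multiplicatively indecomposable (so $\phi$ is a nonzero ordinal or $\phi=\mathbf{On}$, and $\tau=\phi$ is allowed also in the case $\phi=\mathbf{On}$). It is known that for an initial subdomain the height is $\omega^\phi$ with $\phi$ a nonzero additively indecomposable ordinal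 or $\phi=\mathbf{On}$. An ordinal is multiplicatively indecomposable if it has the form $\omega^{\omega^\psi}$ for some ordinal $\psi$ (ordinal exponentiation). For nonzero $\tau\le\phi$, $$A[\omega^\tau]=\{x\in A: -\alpha<x<\alpha\text{ for some ordinal }\alpha<\omega^\tau\}.$$ A subdomain $K$ of $A$ is convex if $x<z<y$ with $x,y\in K$, $z\in A$ implies $z\in K$. *)

(* Defs.v *)
From HB Require Import structures.
From mathcomp Require Import all_boot all_order.
From mathcomp Require Import boolp classical_sets.

Set Implicit Arguments.
Unset Strict Implicit.
Unset Printing Implicit Defensive.

Import Order.TTheory.
Local Open Scope classical_set_scope.
Local Open Scope quotient_scope.
Local Open Scope order_scope.

(** Sets and classes: a set of NBG is a family indexed by a type in the universe
    of the constructor argument of [tree]; [On] and [No] live one universe above,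
    and their subclasses are the predicates [set On] and [set No]. *)

(** ** Ordinals *)

(** A tree with set-many branches at each node stands for its rank
    rank (node f) = sup_a (rank (f a) + 1); every ordinal is the rank of a tree.
    [tree_le] compares ranks, and [On] is the quotient by equality of ranks. *)
Inductive tree := node (A : Type) (f : A -> tree).

Fixpoint tree_le (s t : tree) : Prop :=
  let: node A f := s in let: node B g := t in
  forall a, exists b, tree_le (f a) (g b).

Lemma tree_le_refl s : tree_le s s.
Proof. by elim: s => A f IH /= a; exists a; exact: IH. Qed.

Lemma tree_le_trans s t u : tree_le s t -> tree_le t u -> tree_le s u.
Proof.
elim: s t u => A f IH [B g] [C h] /= st tu a.
have [b ab] := st a; have [c bc] := tu b.
by exists c; exact: IH ab bc.
Qed.

Lemma tree_le_total s t : tree_le s t \/ tree_le t s.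
Proof.
elim: s t => A f IH [B g].
have [st|/existsNP[a /forallNP sNt]] := pselect (tree_le (node f) (node g)).
  by left.
by right => b; exists a; have [/sNt|] := IH a (g b).
Qed.

Lemma tree_leN A (f : A -> tree) t :
  ~ tree_le (node f) t -> exists a, tree_le t (f a).
Proof.
suff N s : ~ tree_le s t -> let: node A f := s in exists a, tree_le t (f a).
  exact: N.
elim: s t => {}A {}f IH [B g] /= /existsNP[a /forallNP faNg]; exists a.
by case: (f a) (IH a) faNg => C h {}IH hNg b /=; exact: IH (hNg b).
Qed.

HB.instance Definition _ := gen_eqMixin tree.
HB.instance Definition _ := gen_choiceMixin tree.

Definition tree_eqv : rel tree := fun s t => `[< tree_le s t /\ tree_le t s >].

Lemma tree_eqv_equiv : equiv_class_of tree_eqv.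
Proof.
split=> [s|s t|t s u].
- by apply/asboolP; split; exact: tree_le_refl.
- by apply/asboolP/asboolP => -[].
- move=> /asboolP[st ts] /asboolP[tu ut]; apply/asboolP.
  by split; [exact: tree_le_trans tu|exact: tree_le_trans ts].
Qed.

Canonical tree_eqv_rel := EquivRelPack tree_eqv_equiv.

Definition On := {eq_quot tree_eqv}.
HB.instance Definition _ := Choice.on On.

Definition On_le : rel On := fun a b => `[< tree_le (repr a) (repr b) >].

Lemma On_le_pi s t : On_le (\pi_On s) (\pi_On t) = `[< tree_le s t >].
Proof.
have reprE u : tree_le (repr (\pi_On u)) u /\ tree_le u (repr (\pi_On u)).
  by apply/asboolP; rewrite -[`[< _ >]]/(tree_eqv _ _); apply/eqmodP; rewrite reprK.
have [s1 s2] := reprE s; have [t1 t2] := reprE t.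
apply/asboolP/asboolP => st; first exact: tree_le_trans (tree_le_trans s2 st) t1.
exact: tree_le_trans (tree_le_trans s1 st) t2.
Qed.

Lemma On_le_refl : reflexive On_le.
Proof. by move=> a; apply/asboolP; exact: tree_le_refl. Qed.

Lemma On_le_anti : antisymmetric On_le.
Proof.
move=> a b /andP[/asboolP ab /asboolP ba].
by rewrite -[a]reprK -[b]reprK; apply/eqmodP/asboolP.
Qed.

Lemma On_le_trans : transitive On_le.
Proof.
by move=> b a c /asboolP ab /asboolP bc; apply/asboolP; exact: tree_le_trans bc.
Qed.

Lemma On_le_total : total On_le.
Proof.
move=> a b; have [ab|ba] := tree_le_total (repr a) (repr b); apply/orP.
  by left; apply/asboolP.
by right; apply/asboolP.
Qed.

Fact On_display : Order.disp_t. Proof. exact: Order.Disp tt tt. Qed.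

HB.instance Definition _ :=
  Order.Le_isPOrder.Build On_display On On_le_refl On_le_anti On_le_trans.
HB.instance Definition _ := Order.POrder_isTotal.Build On_display On On_le_total.

Lemma On_lt_wf : well_founded (fun a b : On => a < b).
Proof.
suff acc t (a : On) : a <= \pi_On t -> Acc (fun a b : On => a < b) a.
  by move=> a; apply: (acc (repr a)); rewrite reprK.
elim: t a => A f IH a at_; constructor => b ba.
have := lt_le_trans ba at_; rewrite -[b]reprK ltNge -[_ <= _]/(On_le _ _) On_le_pi.
move=> /asboolPn/tree_leN[i bi]; apply: (IH i).
by rewrite -[_ <= _]/(On_le _ _) On_le_pi; apply/asboolP.
Qed.

Lemma On_min (P : set On) : P !=set0 -> exists a, P a /\ forall b, P b -> a <= b.
Proof.
case=> a Pa; elim/(well_founded_ind On_lt_wf): a Pa => a IH Pa.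
have [[b [ba Pb]]|noless] := pselect (exists b, b < a /\ P b); first exact: IH Pb.
exists a; split=> // b Pb; rewrite leNgt; apply/negP => ba.
by apply: noless; exists b.
Qed.

Definition On0 : On := \pi_On (node (of_void tree)).

Definition On_least (P : set On) : On :=
  xget On0 [set a | P a /\ forall b, P b -> a <= b].

(** Least upper bound; [P] is bounded above in all uses below. *)
Definition On_sup (P : set On) : On :=
  On_least [set b | forall a, P a -> a <= b].

Definition On_succ (a : On) : On := On_least [set b | a < b].

Definition On1 : On := On_succ On0.

Definition On_omega : On :=
  On_least [set w | On0 < w /\ forall a, a < w -> On_succ a < w].

(** The three clauses (zero, successor, limit) of each recursion are merged:
      a + b = sup ({a} U {(a + c) + 1 : c < b}),
      a * b = sup {a * c + a : c < b},
      omega ^ b = sup ({1} U {omega ^ c * omega : c < b}). *)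
Definition On_add (a : On) : On -> On :=
  Fix On_lt_wf (fun=> On) (fun b rec =>
    On_sup ([set a] `|` [set d | exists c (cb : c < b), d = On_succ (rec c cb)])).

Definition On_mul (a : On) : On -> On :=
  Fix On_lt_wf (fun=> On) (fun b rec =>
    On_sup [set d | exists c (cb : c < b), d = On_add (rec c cb) a]).

Definition omega_pow : On -> On :=
  Fix On_lt_wf (fun=> On) (fun b rec =>
    On_sup ([set On1] `|` [set d | exists c (cb : c < b), d = On_mul (rec c cb) On_omega])).

Lemma FixE T (R : T -> T -> Prop) (wf : well_founded R) S
    (F : forall x, (forall y, R y x -> S) -> S) x :
  Fix wf (fun=> S) F x = F x (fun y _ => Fix wf (fun=> S) F y).
Proof.
apply: (Fix_eq wf (fun=> S)) => {}x f g fg; congr (F x _).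
by apply/functional_extensionality_dep => y; apply/functional_extensionality_dep.
Qed.

Lemma On_addE a b : On_add a b =
  On_sup ([set a] `|` [set On_succ (On_add a c) | c in [set c | c < b]]).
Proof.
rewrite [LHS]FixE -/(On_add a); congr (On_sup (_ `|` _)).
by apply/seteqP; split=> d [c]; [case=> cb ->; exists c|move=> cb <-; exists c, cb].
Qed.

Lemma On_mulE a b : On_mul a b =
  On_sup [set On_add (On_mul a c) a | c in [set c | c < b]].
Proof.
rewrite [LHS]FixE -/(On_mul a); congr On_sup.
by apply/seteqP; split=> d [c]; [case=> cb ->; exists c|move=> cb <-; exists c, cb].
Qed.

Lemma omega_powE b : omega_pow b =
  On_sup ([set On1] `|` [set On_mul (omega_pow c) On_omega | c in [set c | c < b]]).
Proof.
rewrite [LHS]FixE -/omega_pow; congr (On_sup (_ `|` _)).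
by apply/seteqP; split=> d [c]; [case=> cb ->; exists c|move=> cb <-; exists c, cb].
Qed.

(** Ordinals extended by the class of all ordinals. *)
Variant exOn := Ord (a : On) | OnAll.

Definition below (h : exOn) : set On :=
  if h is Ord a then [set b | b < a] else setT.

Definition exOn_le (g h : exOn) : Prop :=
  match g, h with
  | Ord a, Ord b => a <= b
  | _, OnAll => True
  | OnAll, Ord _ => False
  end.

Definition exOmega_pow (h : exOn) : exOn :=
  if h is Ord a then Ord (omega_pow a) else OnAll.

Definition mul_indecomposable (h : exOn) : Prop :=
  if h is Ord a then exists psi, a = omega_pow (omega_pow psi) else True.

(** ** Surreal numbers *)

(** [Some true] is the sign +, [Some false] the sign -, [None] is undefined. *)
Record No := MkNo {
  sgn :> On -> option bool;
  No_length : exists a, forall b, sgn b <> None <-> b < a }.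

HB.instance Definition _ := gen_eqMixin No.
HB.instance Definition _ := gen_choiceMixin No.

Lemma No_eq (x y : No) : sgn x =1 sgn y -> x = y.
Proof.
case: x y => [f fP] [g gP] /= /funext fg; case: g / fg gP => gP.
by congr MkNo; exact: Prop_irrelevance.
Qed.

Definition sgn_rank (s : option bool) : nat :=
  match s with Some false => 0%N | None => 1%N | Some true => 2%N end.

Lemma sgn_rank_inj : injective sgn_rank. Proof. by move=> [[]|] [[]|]. Qed.

Definition No_lt : rel No := fun x y =>
  `[< exists b, (forall c, c < b -> sgn x c = sgn y c) /\
                (sgn_rank (sgn x b) < sgn_rank (sgn y b))%N >].

Lemma No_lt_irr : irreflexive No_lt.
Proof. by move=> x; apply/asboolP => -[b []]; rewrite ltnn. Qed.

Lemma No_lt_trans : transitive No_lt.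
Proof.
move=> y x z /asboolP[b [xy xyb]] /asboolP[c [yz yzc]]; apply/asboolP.
case: (ltgtP b c) => [bc|cb|bc].
- exists b; split; last by rewrite -yz.
  by move=> d db; rewrite xy // yz // (lt_trans db).
- exists c; split; last by rewrite xy.
  by move=> d dc; rewrite xy ?yz // (lt_trans dc).
- exists b; split; last by rewrite (leq_trans xyb) // ltnW // bc.
  by move=> d db; rewrite xy // yz // -bc.
Qed.

Fact No_display : Order.disp_t. Proof. exact: Order.Disp tt tt. Qed.

HB.instance Definition _ :=
  Order.Lt_isPOrder.Build No_display No No_lt_irr No_lt_trans.

Lemma No_ltE (x y : No) : (x < y) = No_lt x y. Proof. by []. Qed.

Lemma No_le_total : total (fun x y : No => x <= y).
Proof.
move=> x y; rewrite !le_eqVlt [y == x]eq_sym; case: eqVneq => //= xNy.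
have [] := @On_min [set b | sgn x b <> sgn y b].
  by apply: contrapT => /forallNP xy; case/eqP: xNy; apply: No_eq => b; apply: contrapT; exact: xy.
move=> b [xyb bmin].
have agree c : c < b -> sgn x c = sgn y c.
  by move=> cb; apply: contrapT => /bmin; rewrite leNgt cb.
have : sgn_rank (sgn x b) != sgn_rank (sgn y b) by apply/eqP => /sgn_rank_inj.
rewrite neq_ltn !No_ltE => /orP[lt_b|lt_b]; apply/orP; [left|right]; apply/asboolP;
  by exists b; split=> // c /agree.
Qed.

HB.instance Definition _ := Order.POrder_isTotal.Build No_display No No_le_total.

(** [x] is a proper initial segment of [y]. *)
Definition simpler (x y : No) : Prop :=
  x <> y /\ forall b, sgn x b <> None -> sgn x b = sgn y b.

Lemma simpler_wf : well_founded simpler.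
Proof.
have len x := cid (No_length x).
suff acc a x : (forall b, sgn x b <> None -> b < a) -> Acc simpler x.
  by move=> x; have [a ax] := len x; apply: (acc a) => b; rewrite ax.
elim/(well_founded_ind On_lt_wf): a x => a IH x xa; constructor => y [yNx yx].
have [c cy] := len y; apply: (IH c); last by move=> b; rewrite cy.
have [b ynb xb] : exists2 b, sgn y b = None & sgn x b <> None.
  apply: contrapT => no; apply: yNx; apply: No_eq => b.
  have [yb|] := pselect (sgn y b = None); last exact: yx.
  rewrite yb; apply: esym; apply: contrapT => xb.
  by apply: no; exists b.
apply: le_lt_trans (xa b xb); rewrite leNgt; apply/negP => bc.
by move/cy: bc; rewrite ynb.
Qed.

Fact No_ord_subproof (a : On) : exists c, forall b,
  (if b < a then Some true else None) <> None <-> b < c.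
Proof. by exists a => b; case: ifP. Qed.

(** The ordinal [a] as a surreal number: [a] signs +. *)
Definition No_ord (a : On) : No := MkNo (No_ord_subproof a).

Definition No0 : No := No_ord On0.
Definition No1 : No := No_ord On1.

(** {L | R}: the simplest surreal number strictly between [L] and [R]. *)
Definition between (L R : set No) : set No :=
  [set z | (forall l, L l -> l < z) /\ (forall r, R r -> z < r)].

Definition cut (L R : set No) : No :=
  xget No0 [set z | between L R z /\ forall w, between L R w -> w <> z -> simpler z w].

(** The canonical options x^L and x^R. *)
Definition lopt (x : No) : set No := [set y | simpler y x /\ y < x].
Definition ropt (x : No) : set No := [set y | simpler y x /\ x < y].

(** Conway's operations, by recursion on simplicity; [No_oppE], [No_addE] and
    [No_mulE] below state the recursive equations. *)
Definition No_opp : No -> No :=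
  Fix simpler_wf (fun=> No) (fun x rec =>
    cut [set z | exists y (yx : simpler y x), x < y /\ z = rec y yx]
        [set z | exists y (yx : simpler y x), y < x /\ z = rec y yx]).

Definition No_add : No -> No -> No :=
  Fix simpler_wf (fun=> No -> No) (fun x recx =>
    Fix simpler_wf (fun=> No) (fun y recy =>
      cut ([set z | exists u (ux : simpler u x), u < x /\ z = recx u ux y] `|`
           [set z | exists v (vy : simpler v y), v < y /\ z = recy v vy])
          ([set z | exists u (ux : simpler u x), x < u /\ z = recx u ux y] `|`
           [set z | exists v (vy : simpler v y), y < v /\ z = recy v vy]))).

Declare Scope No_scope.
Delimit Scope No_scope with No.
Bind Scope No_scope with No.
Notation "x + y" := (No_add x y) : No_scope.
Notation "- x" := (No_opp x) : No_scope.
Notation "x - y" := (No_add x (No_opp y)) : No_scope.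

Definition No_mul : No -> No -> No :=
  Fix simpler_wf (fun=> No -> No) (fun x recx =>
    Fix simpler_wf (fun=> No) (fun y recy =>
      let opts (P : No -> No -> Prop) : set No :=
        [set z | exists u (ux : simpler u x) v (vy : simpler v y),
          P u v /\ z = (recx u ux y + recy v vy - recx u ux v)%No] in
      cut (opts (fun u v => (u < x /\ v < y) \/ (x < u /\ y < v)))
          (opts (fun u v => (u < x /\ y < v) \/ (x < u /\ v < y))))).

Notation "x * y" := (No_mul x y) : No_scope.

Lemma No_oppE x : (- x)%No =
  cut [set (- y)%No | y in ropt x] [set (- y)%No | y in lopt x].
Proof.
rewrite [LHS]FixE -/No_opp; congr cut; apply/seteqP; split=> z.
- by case=> y [yx [xy ->]]; exists y.
- by case=> y [yx xy] <-; exists y, yx.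
- by case=> y [yx [xy ->]]; exists y.
- by case=> y [yx xy] <-; exists y, yx.
Qed.

Lemma No_addE x y : (x + y)%No =
  cut ([set (u + y)%No | u in lopt x] `|` [set (x + v)%No | v in lopt y])
      ([set (u + y)%No | u in ropt x] `|` [set (x + v)%No | v in ropt y]).
Proof.
rewrite {1}/No_add FixE -/No_add FixE.
have -> : Fix simpler_wf (fun=> No) (fun y recy =>
    cut ([set z | exists u (ux : simpler u x), u < x /\ z = No_add u y] `|`
         [set z | exists v (vy : simpler v y), v < y /\ z = recy v vy])
        ([set z | exists u (ux : simpler u x), x < u /\ z = No_add u y] `|`
         [set z | exists v (vy : simpler v y), y < v /\ z = recy v vy])) = No_add x.
  by rewrite /No_add [RHS]FixE.
congr cut; congr setU; apply/seteqP; split=> z;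
  by [case=> w [h [lt ->]]; exists w|case=> w [h lt] <-; exists w, h].
Qed.

Lemma No_mulE x y : (x * y)%No =
  let opt u v := (u * y + x * v - u * v)%No in
  cut ([set opt u v | u in lopt x & v in lopt y] `|`
       [set opt u v | u in ropt x & v in ropt y])
      ([set opt u v | u in lopt x & v in ropt y] `|`
       [set opt u v | u in ropt x & v in lopt y]).
Proof.
rewrite {1}/No_mul FixE -/No_mul FixE.
set F := Fix _ _ _; have -> : F = No_mul x by rewrite /F /No_mul [RHS]FixE.
congr cut; apply/seteqP; split=> z /=.
- case=> u [ux [v [vy [[[lu lv]|[lu lv]] ->]]]]; [left|right];
  by exists u => //; exists v.
- by case=> -[u [ux lu]] [v [vy lv]] <-; exists u, ux, v, vy; split=> //; [left|right].
- case=> u [ux [v [vy [[[lu lv]|[lu lv]] ->]]]]; [left|right];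
  by exists u => //; exists v.
- by case=> -[u [ux lu]] [v [vy lv]] <-; exists u, ux, v, vy; split=> //; [left|right].
Qed.

(** ** Initial subdomains and subfields *)

Definition initial (A : set No) : Prop :=
  forall x y, A x -> simpler y x -> A y.

Definition subdomain (A : set No) : Prop :=
  [/\ A No1,
      forall x y, A x -> A y -> A (x - y)%No &
      forall x y, A x -> A y -> A (x * y)%No].

Definition subfield (A : set No) : Prop :=
  subdomain A /\
  forall x, A x -> x <> No0 -> exists y, A y /\ (x * y)%No = No1.

Definition subdomain_of (K A : set No) : Prop := K `<=` A /\ subdomain K.

Definition convex_in (K A : set No) : Prop :=
  forall x y z, K x -> K y -> A z -> x < z -> z < y -> K z.

(** [A] is [h]-Archimedean: the ordinals in [A] are those below [h]. *)
Definition archimedean (A : set No) (h : exOn) : Prop :=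
  [set a | A (No_ord a)] = below h.

(** A[h] for h = omega^tau. *)
Definition bounded_part (A : set No) (h : exOn) : set No :=
  [set x | A x /\ exists a, below h a /\ (- No_ord a)%No < x /\ x < No_ord a].

(* Main.v *)
Require Import Defs.
From HB Require Import structures.
From mathcomp Require Import all_boot all_order ssralg ssrAC.
From mathcomp Require Import boolp classical_sets.

(** The ordinals of an initial convex subdomain K form an initial segment a of
    On; K is recovered from a, since the longest initial segment of + signs of
    an element of K is an ordinal of K. The Hessenberg sum and product of two
    ordinals, computed in No, dominate the usual ones, so a is closed under
    ordinal addition and multiplication, which forces a = omega^(omega^psi).
    Conversely the ordinals below omega^(omega^psi) are closed under the
    Hessenberg operations, because omega^b is closed under the Hessenberg sum
    and omega^b * omega^c <= omega^(b + c) in No. *)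

Set Implicit Arguments.
Unset Strict Implicit.
Unset Printing Implicit Defensive.

Import Order.TTheory GRing.Theory.
Local Open Scope classical_set_scope.
Local Open Scope quotient_scope.
Local Open Scope order_scope.

(** * Ordinals *)

(** [cut] and [On_sup] return a default value when nothing meets their condition, so Conway's
    equations say nothing until every cut that occurs is known to be inhabited. This takes two
    things: a number between any [L] < [R] of bounded length, obtained by building its sign
    sequence, and the inequalities between options, which must be proved in the same induction as
    the properties of the operation itself. On the ordinal side one-sided estimates suffice. An
    initial segment closed under the Hessenberg operations is closed under the smaller ordinal ones,
    so this direction needs lower bounds for the Hessenberg operations; the converse direction needs
    upper bounds for them. If K contains every ordinal, its segment is not given by an ordinal, and
    tau is [OnAll]. *)

Lemma tree_node_nle A (f : A -> tree) i : ~ tree_le (node f) (f i).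
Proof.
move: {2}(f i) (erefl (f i)) => t; elim: t A f i => B g IH A f i fi.
by rewrite fi => /(_ i)[j]; rewrite fi; exact: IH.
Qed.

Definition tree_rank (t : tree) : On := \pi_On t.

Lemma tree_rank_reprK a : tree_rank (repr a) = a.
Proof. exact: reprK. Qed.

Lemma tree_rank_le s t : (tree_rank s <= tree_rank t) = `[< tree_le s t >].
Proof. exact: On_le_pi. Qed.

(** A node over chosen representatives outranks all of its children; [I] has to be small enough to
    index a node. *)
Lemma On_small_bounded (I : Type) (F : I -> On) : exists d, forall i, F i < d.
Proof.
exists (tree_rank (node (fun i => repr (F i)))) => i.
rewrite -{1}[F i]tree_rank_reprK ltNge tree_rank_le; apply/asboolPn.
exact: (@tree_node_nle _ (fun i => repr (F i))).
Qed.

(** The ordinals below [a] cannot index a node, since [On] lives one universe higher. The induction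
    runs over a tree of rank [a]: an ordinal below [a] is at most the rank of a child, and the
    children have a small index type. *)
Lemma On_replacement (F : On -> On) a : exists d, forall b, b < a -> F b < d.
Proof.
rewrite -[a]tree_rank_reprK; elim: (repr a) => A f /choice[D FD].
have [d1 Dd] := On_small_bounded D.
have [d2 Fd] := On_small_bounded (fun i => F (tree_rank (f i))).
exists (Order.max d1 d2) => b; rewrite -{1}[b]tree_rank_reprK ltNge tree_rank_le.
move=> /asboolPn/tree_leN[i]; rewrite lt_max => bi.
have : b <= tree_rank (f i) by rewrite -[b]tree_rank_reprK tree_rank_le; apply/asboolP.
rewrite le_eqVlt => /orP[/eqP->|/FD bD]; first by rewrite Fd orbT.
by rewrite (lt_trans bD).
Qed.

Lemma On_leastP (P : set On) :
  P !=set0 -> P (On_least P) /\ forall b, P b -> On_least P <= b.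
Proof. by move=> /On_min P_min; exact: (xgetPex On0 P_min). Qed.

Lemma On_least_le (P : set On) b : P b -> On_least P <= b.
Proof. by move=> Pb; have [|_] := @On_leastP P; [exists b|exact]. Qed.

Lemma On_sup_le (P : set On) b : (forall a, P a -> a <= b) -> On_sup P <= b.
Proof. exact: On_least_le. Qed.

(** The bound [d] keeps [On_sup] from taking its default value. *)
Lemma On_sup_ub (P : set On) d a :
  (forall c, P c -> c <= d) -> P a -> a <= On_sup P.
Proof.
by move=> Pd; have [|ub _] := @On_leastP [set b | forall a, P a -> a <= b];
  [exists d|exact: ub].
Qed.

Lemma On_succP a : a < On_succ a /\ forall b, a < b -> On_succ a <= b.
Proof.
by apply: On_leastP; have [d /(_ tt) ad] := On_small_bounded (fun _ : unit => a); exists d.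
Qed.

Lemma On_lt_succ a : a < On_succ a. Proof. by have [] := On_succP a. Qed.

Lemma On_succ_le a b : (On_succ a <= b) = (a < b).
Proof.
apply/idP/idP; first by apply: lt_le_trans; exact: On_lt_succ.
by have [_] := On_succP a; exact.
Qed.

Lemma On_lt_succE a b : (a < On_succ b) = (a <= b).
Proof. by rewrite ltNge On_succ_le -leNgt. Qed.

Lemma On0_le a : On0 <= a.
Proof. by rewrite -[a]tree_rank_reprK -[On0]/(tree_rank _) tree_rank_le; apply/asboolP; case: (repr a) => B g []. Qed.

Lemma On_lt0 a : (a < On0) = false.
Proof. by rewrite ltNge On0_le. Qed.

Lemma On_gt0 a : (On0 < a) = (a != On0).
Proof. by rewrite lt_neqAle On0_le andbT eq_sym. Qed.

Lemma On_lt1 a : (a < On1) = (a == On0).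
Proof. by rewrite /On1 On_lt_succE eq_le On0_le andbT. Qed.

Definition On_nat n := iter n On_succ On0.

Lemma On_omegaP : On0 < On_omega /\ forall a, a < On_omega -> On_succ a < On_omega.
Proof.
have [d nd] := On_small_bounded On_nat.
(* The least ordinal above all [On_nat n] shows that the class defining [On_omega] is inhabited. *)
have [|w_gt w_min] := @On_leastP [set w | forall n, On_nat n < w]; first by exists d.
set w := On_least _ in w_gt w_min.
have [|//] := @On_leastP [set w | On0 < w /\ forall a, a < w -> On_succ a < w].
exists w; split; first exact: (w_gt 0%N).
move=> a aw; apply: contrapT => /negP; rewrite -leNgt => wa.
suff /w_min : [set w | forall n, On_nat n < w] a by rewrite leNgt aw.
by move=> n; rewrite -On_succ_le -[On_succ _]/(On_nat n.+1) -On_lt_succE (lt_le_trans (w_gt _)).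
Qed.

Lemma On_nat_lt_omega n : On_nat n < On_omega.
Proof. by have [w0 wS] := On_omegaP; elim: n => //= n /wS. Qed.

(** An ordinal different from every [On_nat n] exceeds them all; the least ordinal that does so is
    closed under successor, hence at least [On_omega]. *)
Lemma On_lt_omegaP a : a < On_omega -> exists n, a = On_nat n.
Proof.
move=> aw; apply: contrapT => /forallNP aN.
have na n : On_nat n < a.
  elim: n => [|n]; first by rewrite On_gt0; apply/eqP; exact: (aN 0%N).
  by rewrite -On_succ_le lt_neqAle => ->; rewrite andbT eq_sym; apply/eqP; exact: aN.
have [d [dna d_min]] : exists d, (forall n, On_nat n < d) /\
    forall e, (forall n, On_nat n < e) -> d <= e.
  by apply: (@On_min [set w | forall n, On_nat n < w]); exists a.
have : On_omega <= d.
  apply: On_least_le; split; first exact: (dna 0%N).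
  move=> b bd; rewrite ltNge; apply/negP => db.
  suff /d_min : forall n, On_nat n < b by rewrite leNgt bd.
  by move=> n; rewrite -On_succ_le -On_lt_succE; exact: lt_le_trans (dna n.+1) db.
by rewrite leNgt (le_lt_trans (d_min _ na) aw).
Qed.

(** * Ordinal sums and products *)

Lemma On_sup_image (F : On -> On) b c :
  c < b -> F c <= On_sup [set F c | c in [set c | c < b]].
Proof.
move=> cb; have [d Fd] := On_replacement F b.
by apply: (@On_sup_ub _ d) => [_ [e /Fd/ltW ed <-] //|]; exists c.
Qed.

(** Replaces the recursion equation: the sum is the least ordinal that is at least [a] and exceeds
    all earlier sums. Replacement bounds the supremum. *)
Lemma On_add_leP a b d :
  On_add a b <= d <-> a <= d /\ forall c, c < b -> On_add a c < d.
Proof.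
rewrite On_addE; split=> [abd|[ad bd]]; last first.
  by apply: On_sup_le => _ [->//|[c cb <-]]; rewrite On_succ_le bd.
have [e Fe] := On_replacement (fun c => On_succ (On_add a c)) b.
have ub x : ([set a] `|` [set On_succ (On_add a c) | c in [set c | c < b]]) x -> x <= Order.max a e.
  by rewrite le_max => -[->|[c /Fe/ltW ? <-]]; rewrite ?lexx //; apply/orP; right.
split; first by apply: le_trans abd; apply: (On_sup_ub ub); left.
move=> c cb; rewrite -On_succ_le; apply: le_trans abd.
by apply: (On_sup_ub ub); right; exists c.
Qed.

Lemma On_le_addl a b : a <= On_add a b.
Proof. by have [/(_ (lexx _))[le_ab _] _] := On_add_leP a b (On_add a b). Qed.

Lemma On_ltD2l a b c : c < b -> On_add a c < On_add a b.
Proof. by have [/(_ (lexx _))[_ le_ab] _] := On_add_leP a b (On_add a b); exact: le_ab. Qed.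

Lemma On_leD2l a b c : c <= b -> On_add a c <= On_add a b.
Proof. by rewrite le_eqVlt => /orP[/eqP->//|/(On_ltD2l a)/ltW]. Qed.

Lemma On_lt_addP a b d : d < On_add a b -> d < a \/ exists2 c, c < b & d <= On_add a c.
Proof.
rewrite ltNge => /negP dab; apply: contrapT => /not_orP[/negP da /forall2NP db].
apply: dab; apply/On_add_leP; split; first by rewrite leNgt.
by move=> c cb; have [|/negP] := db c; rewrite -?ltNge.
Qed.

Lemma On_addr0 a : On_add a On0 = a.
Proof.
apply/le_anti; rewrite On_le_addl andbT; apply/On_add_leP.
by split=> // c; rewrite On_lt0.
Qed.

Lemma On_leD2r a b c : a <= b -> On_add a c <= On_add b c.
Proof.
move=> ab; elim/(well_founded_ind On_lt_wf): c => c IH; apply/On_add_leP; split.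
  exact: le_trans ab (On_le_addl _ _).
by move=> d dc; apply: le_lt_trans (IH d dc) _; exact: On_ltD2l.
Qed.

(** A strictly increasing map F lowers no ordinal: if F b < b, then F (F b) < F b, so F b is a
    smaller counterexample. *)
Lemma On_le_addr a b : b <= On_add a b.
Proof.
elim/(well_founded_ind On_lt_wf): b => b IH; rewrite leNgt; apply/negP => abb.
by have := IH _ abb; rewrite leNgt On_ltD2l.
Qed.

(** This inequality starts the chain [On_mulDr_le], [On_mulA_le], [omega_powD_le]. *)
Lemma On_addA_le a b c : On_add a (On_add b c) <= On_add (On_add a b) c.
Proof.
elim/(well_founded_ind On_lt_wf): c => c IH; apply/On_add_leP; split.
  exact: le_trans (On_le_addl _ _) (On_le_addl _ _).
move=> e /On_lt_addP[eb|[c' cc e_le]].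
  exact: lt_le_trans (On_ltD2l _ eb) (On_le_addl _ _).
apply: le_lt_trans (On_leD2l _ e_le) _; apply: le_lt_trans (IH _ cc) _.
exact: On_ltD2l.
Qed.

Lemma On_mul_leP a b d :
  On_mul a b <= d <-> forall c, c < b -> On_add (On_mul a c) a <= d.
Proof.
rewrite On_mulE; split=> [abd c cb|bd]; last by apply: On_sup_le => _ [c cb <-]; exact: bd.
by apply: le_trans abd; exact: (On_sup_image (fun c => On_add (On_mul a c) a)).
Qed.

Lemma On_mul_lt_le a b c : c < b -> On_add (On_mul a c) a <= On_mul a b.
Proof. by have [/(_ (lexx _)) le_ab _] := On_mul_leP a b (On_mul a b); exact: le_ab. Qed.

Lemma On_lt_mulP a b d : d < On_mul a b -> exists2 c, c < b & d < On_add (On_mul a c) a.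
Proof.
rewrite ltNge => /negP dab; apply: contrapT => /forall2NP db.
by apply: dab; apply/On_mul_leP => c cb; have [|/negP] := db c; rewrite -?leNgt.
Qed.

Lemma On_leM2l a b c : c <= b -> On_mul a c <= On_mul a b.
Proof.
move=> cb; apply/On_mul_leP => d dc; apply: On_mul_lt_le; exact: lt_le_trans cb.
Qed.

Lemma On_leM2r a b c : a <= b -> On_mul a c <= On_mul b c.
Proof.
move=> ab; elim/(well_founded_ind On_lt_wf): c => c IH; apply/On_mul_leP => d dc.
apply: le_trans (On_mul_lt_le _ dc).
exact: le_trans (On_leD2l _ ab) (On_leD2r _ (IH _ dc)).
Qed.

Lemma On_mulr0 a : On_mul a On0 = On0.
Proof.
apply/le_anti; rewrite On0_le andbT; apply/On_mul_leP => c.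
by rewrite On_lt0.
Qed.

Lemma On_mulrS a b : On_mul a (On_succ b) = On_add (On_mul a b) a.
Proof.
apply/le_anti; rewrite On_mul_lt_le ?On_lt_succ // andbT.
by apply/On_mul_leP => c; rewrite On_lt_succE => cb; exact/On_leD2r/On_leM2l.
Qed.

Lemma On_mulDr_le a b c : On_add (On_mul a b) (On_mul a c) <= On_mul a (On_add b c).
Proof.
elim/(well_founded_ind On_lt_wf): c => c IH; apply/On_add_leP; split.
  exact/On_leM2l/On_le_addl.
move=> e /On_lt_mulP[d dc /(On_ltD2l (On_mul a b)) e_lt].
apply: lt_le_trans e_lt _; apply: le_trans (On_addA_le _ _ _) _.
apply: le_trans (On_leD2r _ (IH _ dc)) _.
exact/On_mul_lt_le/On_ltD2l.
Qed.

Lemma On_mulA_le a b c : On_mul (On_mul a b) c <= On_mul a (On_mul b c).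
Proof.
elim/(well_founded_ind On_lt_wf): c => c IH; apply/On_mul_leP => d dc.
apply: le_trans (On_leD2r _ (IH _ dc)) _.
exact: le_trans (On_mulDr_le _ _ _) (On_leM2l _ (On_mul_lt_le _ dc)).
Qed.

(** * Powers of omega *)

Lemma omega_pow_leP b d :
  omega_pow b <= d <-> On0 < d /\ forall c, c < b -> On_mul (omega_pow c) On_omega <= d.
Proof.
rewrite -On_succ_le -/On1 omega_powE; split=> [bd|[d1 bd]]; last first.
  by apply: On_sup_le => _ [->//|[c cb <-]]; exact: bd.
have [e Fe] := On_replacement (fun c => On_mul (omega_pow c) On_omega) b.
have ub x : ([set On1] `|` [set On_mul (omega_pow c) On_omega | c in [set c | c < b]]) x ->
    x <= Order.max On1 e.
  by rewrite le_max => -[->|[c /Fe/ltW ? <-]]; rewrite ?lexx //; apply/orP; right.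
split; first by apply: le_trans bd; apply: (On_sup_ub ub); left.
by move=> c cb; apply: le_trans bd; apply: (On_sup_ub ub); right; exists c.
Qed.

Lemma omega_pow_gt0 b : On0 < omega_pow b.
Proof. by have [/(_ (lexx _))[le_ab _] _] := omega_pow_leP b (omega_pow b). Qed.

Lemma omega_pow_mul_le b c : c < b -> On_mul (omega_pow c) On_omega <= omega_pow b.
Proof. by have [/(_ (lexx _))[_ le_ab] _] := omega_pow_leP b (omega_pow b); exact: le_ab. Qed.

Lemma lt_omega_powP b d :
  d < omega_pow b -> d = On0 \/ exists2 c, c < b & d < On_mul (omega_pow c) On_omega.
Proof.
rewrite ltNge => /negP db; apply: contrapT => /not_orP[/eqP d0 /forall2NP dN].
apply: db; apply/omega_pow_leP; split; first by rewrite On_gt0.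
by move=> c cb; have [|/negP] := dN c; rewrite -?leNgt.
Qed.

Lemma On_mul_nat_lt_omega a n : On0 < a -> On_mul a (On_nat n) < On_mul a On_omega.
Proof.
move=> a0; apply: lt_le_trans (On_mul_lt_le _ (On_nat_lt_omega n)).
by rewrite -{1}[On_mul a _]On_addr0 On_ltD2l.
Qed.

Lemma omega_pow_lt_mul b : omega_pow b < On_mul (omega_pow b) On_omega.
Proof.
apply: le_lt_trans (On_mul_nat_lt_omega 1 (omega_pow_gt0 b)).
by rewrite /= On_mulrS On_le_addr.
Qed.

Lemma omega_pow_lt b c : c < b -> omega_pow c < omega_pow b.
Proof.
by move=> /omega_pow_mul_le; apply: lt_le_trans; exact: omega_pow_lt_mul.
Qed.

Lemma omega_pow_le b c : c <= b -> omega_pow c <= omega_pow b.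
Proof. by rewrite le_eqVlt => /orP[/eqP->//|/omega_pow_lt/ltW]. Qed.

Lemma le_omega_pow b : b <= omega_pow b.
Proof.
elim/(well_founded_ind On_lt_wf): b => b IH; rewrite leNgt; apply/negP => bb.
by have := IH _ bb; rewrite leNgt omega_pow_lt.
Qed.

Lemma omega_powD_le b c :
  omega_pow (On_add b c) <= On_mul (omega_pow b) (omega_pow c).
Proof.
have mul_gt0 d : omega_pow b <= On_mul (omega_pow b) (omega_pow d).
  apply: le_trans (On_mul_lt_le _ (omega_pow_gt0 d)); exact: On_le_addr.
elim/(well_founded_ind On_lt_wf): c => c IH; apply/omega_pow_leP; split.
  exact: lt_le_trans (omega_pow_gt0 b) (mul_gt0 c).
move=> e /On_lt_addP[eb|[c' cc e_le]].
  exact: le_trans (omega_pow_mul_le eb) (mul_gt0 c).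
apply: le_trans (On_leM2r _ (omega_pow_le e_le)) _.
apply: le_trans (On_leM2r _ (IH _ cc)) _.
exact: le_trans (On_mulA_le _ _ _) (On_leM2l _ (omega_pow_mul_le cc)).
Qed.

(** Take the least b with a <= omega^b. If a < omega^b, then a is below a finite multiple of some
    omega^c with c < b; but omega^c < a by minimality, and closure keeps all its finite multiples
    below a. *)
Lemma add_closed_omega_pow a :
  On0 < a -> (forall b c, b < a -> c < a -> On_add b c < a) ->
  exists b, a = omega_pow b.
Proof.
move=> a0 aD; have [|b [ab b_min]] := @On_min [set b | a <= omega_pow b].
  by exists a; exact: le_omega_pow.
exists b; apply/le_anti; rewrite ab /= leNgt; apply/negP.
move=> /lt_omega_powP[a_eq0|[c cb]]; first by rewrite a_eq0 ltxx in a0.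
have ca : omega_pow c < a.
  by rewrite ltNge; apply/negP => /b_min; rewrite leNgt cb.
move=> /On_lt_mulP[d /On_lt_omegaP[n ->]]; rewrite ltNge => /negP; apply.
apply: ltW; apply: (aD) => //; elim: n => [|n IHn]; first by rewrite On_mulr0.
by rewrite /= On_mulrS aD.
Qed.

(** Additive closure gives a = omega^b. For c, d < b one has omega^(c + d) <= omega^c * omega^d <
    omega^b, so b is additively closed too and is itself a power of omega; a > 1 excludes b = 0. *)
Lemma mul_closed_omega_pow a :
  On1 < a ->
  (forall b c, b < a -> c < a -> On_add b c < a) ->
  (forall b c, b < a -> c < a -> On_mul b c < a) ->
  exists psi, a = omega_pow (omega_pow psi).
Proof.
move=> a1 aD aM.
have [|b ab] := add_closed_omega_pow _ aD; first exact: le_lt_trans (On0_le _) a1.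
have [||psi bp] := @add_closed_omega_pow b; last by exists psi; rewrite ab bp.
  rewrite On_gt0; apply/eqP => b0; move: a1; rewrite ab b0; apply/negP; rewrite -leNgt.
  by apply/omega_pow_leP; split=> [|c]; rewrite ?On_lt_succ // On_lt0.
move=> c d cb db; rewrite ltNge; apply/negP => /omega_pow_le; rewrite -ab leNgt => /negP; apply.
by apply: le_lt_trans (omega_powD_le _ _) (aM _ _ _ _); rewrite ab omega_pow_lt.
Qed.

(** * Surreal numbers as sign sequences *)

Definition len (x : No) : On := sval (cid (No_length x)).

Lemma sgn_lt_len (x : No) b : x b <> None <-> b < len x.
Proof. exact: (svalP (cid (No_length x))). Qed.

Lemma sgn_None (x : No) b : x b = None <-> len x <= b.
Proof.
by rewrite leNgt; split=> [xb|/negP xb]; [apply/negP => /sgn_lt_len|apply: contrapT => /sgn_lt_len].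
Qed.

Lemma len_le (x : No) a : (forall b, x b <> None -> b < a) -> len x <= a.
Proof. by move=> xa; rewrite leNgt; apply/negP => /sgn_lt_len/xa; rewrite ltxx. Qed.

Fact trunc_subproof (x : No) (a : On) : exists c, forall b,
  (if b < a then x b else None) <> None <-> b < c.
Proof.
exists (Order.min a (len x)) => b; rewrite lt_min.
by case: ifP => //= _; exact: sgn_lt_len.
Qed.

Definition trunc (x : No) (a : On) : No := MkNo (trunc_subproof x a).

Definition No_prefix (x y : No) : Prop := forall b, x b <> None -> x b = y b.

Lemma simplerE x y : simpler x y <-> x <> y /\ No_prefix x y. Proof. by []. Qed.

Lemma trunc_prefix x a : No_prefix (trunc x a) x.
Proof. by move=> b /=; case: ifP. Qed.

Lemma prefix_trunc x y : No_prefix x y -> x = trunc y (len x).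
Proof.
move=> xy; apply: No_eq => b /=; case: ifP => [/sgn_lt_len/xy//|/negbT].
by rewrite -leNgt => /sgn_None.
Qed.

Lemma prefix_len x y : No_prefix x y -> len x <= len y.
Proof. by move=> xy; apply: len_le => b xb; apply/sgn_lt_len; rewrite -xy. Qed.

Lemma simpler_len x y : simpler x y -> len x < len y.
Proof.
move=> [xNy xy]; rewrite lt_neqAle prefix_len // andbT; apply/eqP => lxy.
by apply: xNy; have := prefix_trunc xy; rewrite lxy -(@prefix_trunc y y).
Qed.

Lemma simpler_irr x : ~ simpler x x. Proof. by case. Qed.

Lemma prefix_trans x y z : No_prefix x y -> No_prefix y z -> No_prefix x z.
Proof. by move=> xy yz b xb; rewrite xy // yz // -xy. Qed.

Lemma simpler_trans x y z : simpler x y -> simpler y z -> simpler x z.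
Proof.
move=> xy yz; split; last exact: prefix_trans xy.2 yz.2.
by move=> xz; have := lt_trans (simpler_len xy) (simpler_len yz); rewrite xz ltxx.
Qed.

Lemma prefix_simpler x y : No_prefix x y -> x = y \/ simpler x y.
Proof. by move=> xy; have [|] := pselect (x = y); [left|right]. Qed.

Lemma simpler_prefix_total x y z : No_prefix x z -> No_prefix y z -> No_prefix x y \/ No_prefix y x.
Proof.
move=> xz yz; have [le_xy|/ltW le_yx] := leP (len x) (len y); [left|right] => b.
  by move=> xb; rewrite xz // yz //; apply/sgn_lt_len; apply: lt_le_trans le_xy; apply/sgn_lt_len.
by move=> yb; rewrite yz // xz //; apply/sgn_lt_len; apply: lt_le_trans le_yx; apply/sgn_lt_len.
Qed.

Lemma No_ltP (x y : No) : x < y <->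
  exists b, (forall c, c < b -> x c = y c) /\ (sgn_rank (x b) < sgn_rank (y b))%N.
Proof. by split=> [/asboolP|xy]; [|apply/asboolP]. Qed.

(** In the third case, [m] is the longest common prefix. *)
Lemma No_lt_cases (x y : No) : x < y ->
  [\/ simpler x y, simpler y x |
      exists m, [/\ simpler m x, simpler m y, x < m & m < y]].
Proof.
move=> xy; have [b [agree lt_b]] := (No_ltP x y).1 xy.
have xNy : x <> y by move=> exy; rewrite exy ltxx in xy.
case xb : (x b) lt_b => [s|]; last first.
  move=> _; apply: Or31; split=> // c /sgn_lt_len cx; apply: agree.
  by apply: lt_le_trans cx _; apply/sgn_None.
case yb : (y b) => [t|]; last first.
  move=> _; apply: Or32; split; first exact: nesym.
  move=> c /sgn_lt_len cy; apply/esym/agree.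
  by apply: lt_le_trans cy _; apply/sgn_None.
case: s t xb yb => -[] // xb yb _; apply: Or33; exists (trunc x b).
have mb : trunc x b b = None by rewrite /= ltxx.
have mE c : c < b -> trunc x b c = x c by move=> /= ->.
split.
- by split; [move=> mx; rewrite -mx mb in xb|exact: trunc_prefix].
- split; first by move=> my; rewrite -my mb in yb.
  by move=> c /=; case: ifP => // cb _; exact: agree.
- by apply/No_ltP; exists b; split; [move=> c cb; rewrite mE|rewrite mb xb].
- by apply/No_ltP; exists b; split; [move=> c cb; rewrite mE // agree|rewrite mb yb].
Qed.

Fact flip_subproof (x : No) : exists c, forall b, omap negb (x b) <> None <-> b < c.
Proof. by exists (len x) => b; rewrite -sgn_lt_len; case: (x b). Qed.

Definition flip (x : No) : No := MkNo (flip_subproof x).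

Lemma flipK : involutive flip.
Proof. by move=> x; apply: No_eq => b /=; case: (x b) => [[]|]. Qed.

Lemma flip_lt x y : (flip x < flip y) = (y < x).
Proof.
suff imp u v : u < v -> flip v < flip u.
  by apply/idP/idP => /imp //; rewrite !flipK.
move=> /No_ltP[b [agree lt_b]]; apply/No_ltP; exists b; split.
  by move=> c /agree /= ->.
by move: lt_b => /=; case: (u b) => [[]|]; case: (v b) => [[]|].
Qed.

Lemma flip_simpler x y : simpler x y -> simpler (flip x) (flip y).
Proof.
move=> [xNy xy]; split; first by move=> /(can_inj flipK).
by move=> b /=; have := xy b; case: (x b) => //= s <-.
Qed.

(** ** Cuts *)

(** Expresses that [S] is a set rather than a proper class. *)
Definition bounded_len (S : set No) : Prop := exists a, forall z, S z -> len z <= a.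

Lemma bounded_lenU S T : bounded_len S -> bounded_len T -> bounded_len (S `|` T).
Proof.
move=> [a Sa] [b Tb]; exists (Order.max a b) => z.
by rewrite le_max => -[/Sa->|/Tb->] //; rewrite orbT.
Qed.

Lemma bounded_len_sub S T : S `<=` T -> bounded_len T -> bounded_len S.
Proof. by move=> ST [a Ta]; exists a => z /ST/Ta. Qed.

(** The numbers simpler than [x] are its truncations, hence indexed by the ordinals below [len x],
    and replacement applies. *)
Lemma bounded_len_simpler (S : No -> set No) x :
  (forall u, simpler u x -> bounded_len (S u)) ->
  bounded_len [set z | exists2 u, simpler u x & S u z].
Proof.
move=> Sb; have /choice[f fP] b : exists d, simpler (trunc x b) x ->
    forall z, S (trunc x b) z -> len z <= d.
  have [/Sb[d Sd]|no] := pselect (simpler (trunc x b) x); first by exists d.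
  by exists On0.
have [d fd] := On_replacement f (len x); exists d => z [u ux Suz].
have u_trunc := prefix_trunc ux.2.
have := fP (len u); rewrite -u_trunc => /(_ ux _ Suz)/le_trans; apply.
exact/ltW/fd/simpler_len.
Qed.

Lemma bounded_len1 z : bounded_len [set z].
Proof. by exists (len z) => _ ->. Qed.

Lemma between_convex L R u v w :
  between L R u -> between L R v -> u < w -> w < v -> between L R w.
Proof.
move=> [Lu _] [_ Rv] uw wv; split=> [l /Lu lu|r /Rv vr].
  exact: lt_trans uw.
exact: lt_trans vr.
Qed.

(** An element minimal for simplicity is simpler than all others: if neither it nor [v] is a prefix
    of the other, their longest common prefix lies between them and contradicts minimality. *)
Lemma between_simplest L R z : between L R z ->
  exists w, between L R w /\ forall v, between L R v -> v <> w -> simpler w v.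
Proof.
elim/(well_founded_ind simpler_wf): z => z IH Bz.
have [[w [wz Bw]]|no] := pselect (exists w, simpler w z /\ between L R w).
  exact: IH Bw.
exists z; split=> // v Bv vNz.
have zNv : ~ simpler v z by move=> vz; apply: no; exists v.
have noB m : simpler m z -> ~ between L R m by move=> mz Bm; apply: no; exists m.
have [vz|zv|vz] := ltgtP v z; last by [].
- have [||[m [mv mz vm /(between_convex Bv Bz vm)]]] := No_lt_cases vz => //.
  by move/noB.
- have [||[m [mz mv zm mlv]]] := No_lt_cases zv => //.
  by have /noB := between_convex Bz Bv zm mlv.
Qed.

Lemma cut_between L R : between L R !=set0 -> between L R (cut L R).
Proof. by case=> z /between_simplest/(xgetPex No0)[]. Qed.

Lemma cut_simplest L R w : between L R w -> w = cut L R \/ simpler (cut L R) w.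
Proof.
move=> Bw; have [|wNc] := pselect (w = cut L R); first by left.
by right; have /between_simplest/(xgetPex No0)[_ ] := Bw; apply.
Qed.

Lemma cut_eq L R z : between L R z -> (forall w, simpler w z -> ~ between L R w) ->
  cut L R = z.
Proof.
move=> Bz z_min; have [//|/z_min[]] := cut_simplest Bz.
by apply: cut_between; exists z.
Qed.

(** Each cut is simplest in its own class, so neither can be strictly simpler than the other.
    Identities thus reduce to inequalities between options. *)
Lemma cut_eq_cut L R L' R' :
  between L R (cut L' R') -> between L' R' (cut L R) -> cut L R = cut L' R'.
Proof.
move=> B B'; have [//|s] := cut_simplest B; have [//|s'] := cut_simplest B'.
by have [] := simpler_irr (simpler_trans s s').
Qed.

(** Cofinality of the canonical options: a [w] below the cut and above all of [L] would be a member
    of the class simpler than the cut. *)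
Lemma lopt_cut L R w : between L R !=set0 -> lopt (cut L R) w -> exists2 l, L l & w <= l.
Proof.
move=> ne [ws wlt]; have [Lc Rc] := cut_between ne; apply: contrapT => /forall2NP noL.
have : between L R w.
  split=> [l Ll|r Rr]; last exact: lt_trans (Rc r Rr).
  by rewrite ltNge; apply/negP => wl; case: (noL l) => [/(_ Ll)|/(_ wl)].
case/cut_simplest => [wE|/(simpler_trans ws)/simpler_irr//].
by move: wlt; rewrite wE ltxx.
Qed.

Lemma ropt_cut L R w : between L R !=set0 -> ropt (cut L R) w -> exists2 r, R r & r <= w.
Proof.
move=> ne [ws wlt]; have [Lc Rc] := cut_between ne; apply: contrapT => /forall2NP noR.
have : between L R w.
  split=> [l /Lc lc|r Rr]; first exact: lt_trans wlt.
  by rewrite ltNge; apply/negP => wr; case: (noR r) => [/(_ Rr)|/(_ wr)].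
case/cut_simplest => [wE|/(simpler_trans ws)/simpler_irr//].
by move: wlt; rewrite wE ltxx.
Qed.

(** * Existence of a number between two classes of bounded length *)

Lemma trunc_le (x : No) c : x c <> Some false -> trunc x c <= x.
Proof.
move=> xc; rewrite leNgt; apply/negP => /No_ltP[b [agree]] /=.
have [bc|cb|->] := ltgtP b c; first by rewrite ltnn.
  have /sgn_None cx : x c = None by rewrite agree //= ltxx.
  by have /sgn_None-> := le_trans cx (ltW cb).
by case: (x c) xc => [[]|].
Qed.

Lemma flip_trunc x c : flip (trunc x c) = trunc (flip x) c.
Proof. by apply: No_eq => b /=; case: ifP. Qed.

Lemma le_trunc (x : No) c : x c <> Some true -> x <= trunc x c.
Proof.
move=> xc; rewrite leNgt -flip_lt -leNgt flip_trunc; apply: trunc_le => /=.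
by case: (x c) xc => [[]|].
Qed.

Fact snoc_subproof (x : No) (s : bool) : exists c, forall b,
  (if b < len x then x b else if b == len x then Some s else None) <> None <-> b < c.
Proof.
exists (On_succ (len x)) => b; rewrite On_lt_succE.
by case: (ltgtP b (len x)) => // /sgn_lt_len.
Qed.

Definition snoc (x : No) (s : bool) : No := MkNo (snoc_subproof x s).

Lemma len_snoc x s : len (snoc x s) = On_succ (len x).
Proof.
apply/le_anti; apply/andP; split.
  apply: len_le => b; rewrite On_lt_succE /=; by case: (ltgtP b (len x)).
by rewrite On_succ_le; apply/sgn_lt_len; rewrite /= ltxx eqxx.
Qed.

(** The sign expansion of the cut {L | R} follows this greedy rule: go up
    while some element of L has not been passed, down for R. *)
Definition descent (L R : set No) (p : No) : Prop := forall c, c < len p ->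
  (p c = Some true /\ exists2 l, L l & trunc p c <= l) \/
  (p c = Some false /\ exists2 r, R r & r <= trunc p c).

Lemma trunc_eq (x y : No) c : (forall d, d < c -> x d = y d) -> trunc x c = trunc y c.
Proof. by move=> xy; apply: No_eq => d /=; case: ifP => // /xy. Qed.

(** At a first difference both sequences share a truncation t, with t <= l for some l in [L] and r
    <= t for some r in [R], against l < r. *)
Lemma descent_agree (L R : set No) p q c :
  (forall l r, L l -> R r -> l < r) -> descent L R p -> descent L R q ->
  c < len p -> c < len q -> p c = q c.
Proof.
move=> LR dp dq; elim/(well_founded_ind On_lt_wf): c => c IH cp cq.
have pq : trunc p c = trunc q c.
  by apply: trunc_eq => d dc; apply: IH => //; exact: lt_trans dc _.
case: (dp c cp) (dq c cq) => -[-> [z Zz zt]] [[-> [w Ww wt]]|[-> [w Ww wt]]] //.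
- by have := LR _ _ Zz Ww; rewrite ltNge (le_trans wt) // -pq.
- by have := LR _ _ Ww Zz; rewrite ltNge (le_trans zt) // pq.
Qed.

(** Suppose the sign at [a] is forced by some z in [L]. Being longer than z, the truncation at [a]
    first differs from z at some c < a and is smaller there. So p turned down at c, because of some
    r <= [trunc p c] <= z, which is impossible. The case of [R] is symmetric. *)
Lemma descent_len (L R : set No) a p :
  (forall l r, L l -> R r -> l < r) ->
  (forall z, (L `|` R) z -> len z < a) -> descent L R p -> len p <= a.
Proof.
move=> LR lenLR dp; rewrite leNgt; apply/negP => ap.
have ta c : c < a -> trunc p a c = p c by move=> /= ->.
have tN c : a <= c -> trunc p a c = None by rewrite leNgt /= => /negbTE->.
have pN c : c < a -> p c <> None by move=> ca; apply/sgn_lt_len/(lt_trans ca).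
case: (dp _ ap) => -[_ [z Zz]].
  have za : len z < a by apply: lenLR; left.
  rewrite le_eqVlt => /orP[/eqP tz|/No_ltP[c [agree lt_c]]].
    by have := pN _ za; rewrite -ta // tz => /sgn_lt_len; rewrite ltxx.
  have ca : c < a.
    rewrite ltNge; apply/negP => ac; move: lt_c; rewrite tN //.
    by have /sgn_None-> : len z <= c by exact/ltW/(lt_le_trans za).
  move: lt_c; rewrite ta // => lt_c.
  case: (dp c (lt_trans ca ap)) => -[pc]; first by move: lt_c; rewrite pc; case: (z c) => [[]|].
  move=> [r Rr rp]; have := LR _ _ Zz Rr; rewrite ltNge (le_trans rp) //.
  rewrite (@trunc_eq p z) => [|d dc]; last by rewrite -agree // ta // (lt_trans dc).
  by apply: trunc_le; move: lt_c; rewrite pc; case: (z c) => [[]|].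
have za : len z < a by apply: lenLR; right.
rewrite le_eqVlt => /orP[/eqP tz|/No_ltP[c [agree lt_c]]].
  by have := pN _ za; rewrite -ta // -tz => /sgn_lt_len; rewrite ltxx.
have ca : c < a.
  rewrite ltNge; apply/negP => ac; move: lt_c; rewrite tN //.
  by have /sgn_None-> : len z <= c by exact/ltW/(lt_le_trans za).
move: lt_c; rewrite ta // => lt_c.
case: (dp c (lt_trans ca ap)) => -[pc]; last by move: lt_c; rewrite pc; case: (z c) => [[]|].
move=> [l Ll pl]; have := LR _ _ Ll Zz; rewrite ltNge (le_trans _ pl) //.
rewrite (@trunc_eq p z) => [|d dc]; last by rewrite agree // ta // (lt_trans dc).
by apply: le_trunc; move: lt_c; rewrite pc; case: (z c) => [[]|].
Qed.

(** The union of all descents is a longest descent [u]; were an element of [L] or [R] not passed by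
    [u], appending one sign would give a longer one. *)
Lemma between_nonempty (L R : set No) :
  bounded_len L -> bounded_len R -> (forall l r, L l -> R r -> l < r) ->
  between L R !=set0.
Proof.
move=> bL bR LR; have [a aLR] := bounded_lenU bL bR.
have lenLR z : (L `|` R) z -> len z < On_succ a by move=> /aLR; rewrite On_lt_succE.
pose U := [set b | exists p, descent L R p /\ b < len p].
have U_down b c : b < c -> U c -> U b.
  by move=> bc [p [dp cp]]; exists p; split=> //; exact: lt_trans cp.
have [c [cU c_min]] : exists c, (forall b, U b -> b < c) /\
    forall d, (forall b, U b -> b < d) -> c <= d.
  apply: (@On_min [set c | forall b, U b -> b < c]); exists (On_succ (On_succ a)) => b [p [dp bp]].
  by rewrite On_lt_succE; apply/ltW/(lt_le_trans bp)/(descent_len LR lenLR).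
have Uc b : U b <-> b < c.
  split=> [/cU//|bc]; apply: contrapT => Ub.
  suff /c_min : forall d, U d -> d < b by rewrite leNgt bc.
  move=> d Ud; rewrite ltNge le_eqVlt; apply/negP => /orP[/eqP bd|bd].
    by apply: Ub; rewrite bd.
  exact: Ub (U_down _ _ bd Ud).
(* The sign at [b] is copied from any descent reaching beyond [b]; [descent_agree] makes the choice
   irrelevant. *)
have /choice[f fP] b : exists s,
    (b < c -> exists p, [/\ descent L R p, b < len p & s = p b]) /\ (c <= b -> s = None).
  have [/Uc[p [dp bp]]|cb] := ltP b c; last by exists None.
  by exists (p b); split=> // _; exists p.
have fN b : f b <> None <-> b < c.
  have [fc cf] := fP b; split=> [fb|/fc[p [_ bp ->]]]; last exact/sgn_lt_len.
  by rewrite ltNge; apply/negP => /cf.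
pose u := MkNo (ex_intro (fun a => forall b, f b <> None <-> b < a) c fN).
have lu : len u = c.
  apply/le_anti/andP; split; first by apply: len_le => b /fN.
  by rewrite leNgt; apply/negP => /fN/(sgn_lt_len u); rewrite ltxx.
have up p b : descent L R p -> b < len p -> u b = p b.
  move=> dp bp; have /Uc bc : U b by exists p.
  by have [/(_ bc)[q [dq bq ub]] _] := fP b; rewrite [LHS]ub; exact: (descent_agree LR).
have du : descent L R u.
  move=> b; rewrite lu => /Uc[p [dp bp]]; rewrite (up p) //.
  rewrite (@trunc_eq u p) => [|d db]; first exact: dp.
  by apply: up => //; exact: lt_trans bp.
have dsnoc s : ~ descent L R (snoc u s).
  move=> ds; have := up _ (len u) ds; rewrite len_snoc On_lt_succ => /(_ isT).
  by rewrite [RHS]/= ltxx eqxx (sgn_None u _).2.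
have dsnoc' s : (s = true /\ exists2 l, L l & u <= l) \/
    (s = false /\ exists2 r, R r & r <= u) -> descent L R (snoc u s).
  have tr b : b <= len u -> trunc (snoc u s) b = trunc u b.
    by move=> bu; apply: trunc_eq => d db /=; rewrite (lt_le_trans db).
  move=> us b; rewrite len_snoc On_lt_succE => bu; rewrite tr //.
  move: bu; rewrite le_eqVlt => /orP[/eqP->|bu].
    rewrite /= ltxx eqxx -(@prefix_trunc u u) //.
    by case: us => -[-> ?]; [left|right].
  by rewrite /= bu; exact: du.
exists u; split=> [l Ll|r Rr]; rewrite ltNge; apply/negP => ul.
  by apply: (dsnoc true); apply: dsnoc'; left; split=> //; exists l.
by apply: (dsnoc false); apply: dsnoc'; right; split=> //; exists r.
Qed.

(** ** Ordinals as surreal numbers *)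

Lemma sgn_No_ord a b : No_ord a b = if b < a then Some true else None.
Proof. by []. Qed.

Lemma len_No_ord a : len (No_ord a) = a.
Proof.
apply/le_anti/andP; split; first by apply: len_le => b; rewrite sgn_No_ord; case: ifP.
by rewrite leNgt; apply/negP => la; have := (sgn_None (No_ord a) _).2 (lexx _); rewrite sgn_No_ord la.
Qed.

Lemma le_No_ord_sgn a (x : No) c : No_ord a <= x -> c < a -> x c = Some true.
Proof.
rewrite leNgt => /negP ax; elim/(well_founded_ind On_lt_wf): c => c IH ca.
apply: contrapT => xc; apply: ax; apply/No_ltP; exists c; split.
  by move=> d dc; rewrite IH // ?sgn_No_ord (lt_trans dc ca).
by rewrite sgn_No_ord ca; case: (x c) xc => [[]|].
Qed.

Lemma lt_No_ordP a (x : No) : No_ord a < x <-> forall c, c <= a -> x c = Some true.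
Proof.
split=> [ax c|xa]; last first.
  apply/No_ltP; exists a; rewrite sgn_No_ord ltxx xa //; split=> // c ca.
  by rewrite sgn_No_ord ca xa // ltW.
rewrite le_eqVlt => /orP[/eqP->|]; last exact: le_No_ord_sgn (ltW ax).
move: ax => /No_ltP[b [agree]]; rewrite sgn_No_ord; have [ba|ab|->] := ltgtP b a.
- by case: (x b) => [[]|].
- have /sgn_None xa : x a = None by rewrite -agree // sgn_No_ord ltxx.
  by have /sgn_None-> := le_trans xa (ltW ab).
- by case: (x a) => [[]|].
Qed.

Lemma No_ord_lt a b : (No_ord a < No_ord b) = (a < b).
Proof.
apply/idP/idP => [/lt_No_ordP/(_ a (lexx a))|ab].
  by rewrite sgn_No_ord; case: ifP.
by apply/lt_No_ordP => c /le_lt_trans/(_ ab) cb; rewrite sgn_No_ord cb.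
Qed.

Lemma No_ord_le a b : (No_ord a <= No_ord b) = (a <= b).
Proof. by rewrite !leNgt No_ord_lt. Qed.

Lemma No_ord_prefix a b : a <= b -> No_prefix (No_ord a) (No_ord b).
Proof.
move=> ab c; rewrite !sgn_No_ord; case: ifP => // ca _.
by rewrite (lt_le_trans ca).
Qed.

Lemma lt_No_ord_len x : x < No_ord (On_succ (len x)).
Proof.
rewrite ltNge; apply/negP => /le_No_ord_sgn/(_ (On_lt_succ _)).
by rewrite (sgn_None x _).2.
Qed.

Lemma prefix_No_ord x a : No_prefix x (No_ord a) -> x = No_ord (len x).
Proof.
move=> xa; rewrite {1}(prefix_trunc xa); apply: No_eq => b.
rewrite /= ; case: ifP => // bx; rewrite (lt_le_trans bx) //.
by rewrite -[a]len_No_ord prefix_len.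
Qed.

Lemma simpler_No_ord a x : simpler x (No_ord a) <-> exists2 b, b < a & x = No_ord b.
Proof.
split=> [xa|[b ba ->]].
  exists (len x); last exact: prefix_No_ord xa.2.
  by rewrite -[ltRHS]len_No_ord; exact: simpler_len.
split; last exact/No_ord_prefix/ltW.
by move=> /(congr1 len); rewrite !len_No_ord => ab; rewrite ab ltxx in ba.
Qed.

Lemma lopt_No_ord a x : lopt (No_ord a) x <-> exists2 b, b < a & x = No_ord b.
Proof.
split=> [[/simpler_No_ord]//|[b ba ->]]; split; last by rewrite No_ord_lt.
by apply/simpler_No_ord; exists b.
Qed.

Lemma ropt_No_ord a : ropt (No_ord a) = set0.
Proof.
apply/seteqP; split=> // x [/simpler_No_ord[b ba ->]].
by rewrite No_ord_lt ltNge ltW.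
Qed.

(** Without right members some ordinal lies in the class, so the cut is a prefix of an ordinal. *)
Lemma cut_No_ord L : bounded_len L -> exists a, cut L set0 = No_ord a.
Proof.
move=> bL; have b0 : bounded_len set0 by exists On0.
have [Lc _] := cut_between (between_nonempty bL b0 (fun _ _ _ => False_ind _)).
have /cut_simplest[ez|[_ /prefix_No_ord ez]] :
    between L set0 (No_ord (On_succ (len (cut L set0)))).
- by split=> // l /Lc lz; exact: lt_trans (lt_No_ord_len _).
- by exists (On_succ (len (cut L set0))).
- by exists (len (cut L set0)).
Qed.

(** * The ordered group of surreal numbers *)

Local Open Scope No_scope.

Definition addL (x y : No) : set No :=
  [set u + y | u in lopt x] `|` [set x + v | v in lopt y].

Definition addR (x y : No) : set No :=
  [set u + y | u in ropt x] `|` [set x + v | v in ropt y].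

Lemma bounded_len_image (F : No -> No) x (S : set No) :
  (forall u, S u -> simpler u x) -> bounded_len [set F u | u in S].
Proof.
move=> Sx; apply: (@bounded_len_sub _ [set z | exists2 u, simpler u x & [set F u] z]).
  by move=> _ [u /Sx ux <-]; exists u.
by apply: bounded_len_simpler => u _; exact: bounded_len1.
Qed.

(** Two prefixes of [x] are comparable for simplicity, so one is an option of the other. The
    hypotheses concern only numbers simpler than [x], as an induction on [x] provides them. *)
Lemma options_mono (F : No -> No) x u w :
  (forall w, simpler w x -> forall u, lopt w u -> F u < F w) ->
  (forall w, simpler w x -> forall u, ropt w u -> F w < F u) ->
  simpler u x -> simpler w x -> u < w -> F u < F w.
Proof.
move=> lF rF ux wx uw; have uNw : u <> w by move=> e; rewrite e ltxx in uw.
have [/simplerE uPw|/simplerE wPu] : simpler u w \/ simpler w u.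
- by have [p|p] := simpler_prefix_total ux.2 wx.2; [left|right; split=> //; exact: nesym].
- exact: lF.
- exact: rF.
Qed.

Lemma No_add_ne_between x y : between (addL x y) (addR x y) !=set0.
Proof.
(* The induction also carries that [x + y] lies in its own cut: for simpler arguments this is what
   orders the options. *)
suff [] : between (addL x y) (addR x y) !=set0 /\ between (addL x y) (addR x y) (x + y) by [].
elim/(well_founded_ind simpler_wf): x y => x IHx.
elim/(well_founded_ind simpler_wf) => y IHy.
suff ne : between (addL x y) (addR x y) !=set0.
  by split=> //; rewrite No_addE; exact: cut_between.
have {}IHx u z : simpler u x -> between (addL u z) (addR u z) (u + z) by move=> /IHx/(_ z)[].
have {}IHy v : simpler v y -> between (addL x v) (addR x v) (x + v) by move=> /IHy[].
have ltx u u' : simpler u x -> simpler u' x -> u < u' -> u + y < u' + y.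
  apply: (@options_mono (fun u => u + y)) => w wx v vw; have [lt_ gt_] := IHx w y wx.
    by apply: lt_; left; exists v.
  by apply: gt_; left; exists v.
have lty v v' : simpler v y -> simpler v' y -> v < v' -> x + v < x + v'.
  apply: (@options_mono (fun v => x + v)) => w wy v'' vw; have [lt_ gt_] := IHy w wy.
    by apply: lt_; right; exists v''.
  by apply: gt_; right; exists v''.
apply: between_nonempty.
- by apply: bounded_lenU; [apply: (@bounded_len_image _ x)|apply: (@bounded_len_image _ y)] => u [].
- by apply: bounded_lenU; [apply: (@bounded_len_image _ x)|apply: (@bounded_len_image _ y)] => u [].
move=> _ _ [[u [us ux] <-]|[v [vs vy] <-]] [[u' [us' ux'] <-]|[v' [vs' vy'] <-]].
- exact/ltx/(lt_trans ux).
(* Options that change different arguments are compared through the sum in which both are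
   changed. *)
- apply: (@lt_trans _ _ (u + v')).
    by have [_] := IHx u y us; apply; right; exists v'.
  by have [+ _] := IHy v' vs'; apply; left; exists u.
- apply: (@lt_trans _ _ (u' + v)).
    by have [_] := IHy v vs; apply; left; exists u'.
  by have [+ _] := IHx u' y us'; apply; right; exists v.
- exact/lty/(lt_trans vy).
Qed.

Lemma No_add_between x y : between (addL x y) (addR x y) (x + y).
Proof. rewrite No_addE; exact/cut_between/No_add_ne_between. Qed.

Lemma lopt_add x y w : lopt (x + y) w ->
  (exists2 u, lopt x u & w <= u + y) \/ (exists2 v, lopt y v & w <= x + v).
Proof.
rewrite No_addE => /lopt_cut[|_ [[u xu <-]|[v yv <-]] wle]; first exact: No_add_ne_between.
  by left; exists u.
by right; exists v.
Qed.

Lemma ropt_add x y w : ropt (x + y) w ->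
  (exists2 u, ropt x u & u + y <= w) \/ (exists2 v, ropt y v & x + v <= w).
Proof.
rewrite No_addE => /ropt_cut[|_ [[u xu <-]|[v yv <-]] wle]; first exact: No_add_ne_between.
  by left; exists u.
by right; exists v.
Qed.

(** Two numbers incomparable for simplicity have their longest common prefix strictly between them,
    and it is an option of both. *)
Lemma No_homo (F : No -> No) :
  (forall x u, lopt x u -> F u < F x) -> (forall x u, ropt x u -> F x < F u) ->
  {homo F : x y / x < y}.
Proof.
move=> lF rF x y xy; have [s|s|[m [mx my xm my']]] := No_lt_cases xy.
- exact: lF.
- exact: rF.
- by apply: (@lt_trans _ _ (F m)); [exact: rF|exact: lF].
Qed.

Lemma No_lt_add2r z x y : x < y -> x + z < y + z.
Proof.
move: x y; apply: (@No_homo (fun x => x + z)) => x u xu; have [lt_ gt_] := No_add_between x z.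
  by apply: lt_; left; exists u.
by apply: gt_; left; exists u.
Qed.

Lemma No_lt_add2l z x y : x < y -> z + x < z + y.
Proof.
move: x y; apply: (@No_homo (fun x => z + x)) => x u xu; have [lt_ gt_] := No_add_between z x.
  by apply: lt_; right; exists u.
by apply: gt_; right; exists u.
Qed.

Lemma No_le_add2r z x y : x <= y -> x + z <= y + z.
Proof. by rewrite le_eqVlt => /orP[/eqP->//|/(No_lt_add2r z)/ltW]. Qed.

Lemma No_le_add2l z x y : x <= y -> z + x <= z + y.
Proof. by rewrite le_eqVlt => /orP[/eqP->//|/(No_lt_add2l z)/ltW]. Qed.

Lemma No_addC : commutative No_add.
Proof.
elim/(well_founded_ind simpler_wf) => x IHx; elim/(well_founded_ind simpler_wf) => y IHy.
have ex (S : set No) : (forall u, S u -> simpler u x) ->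
    [set u + y | u in S] = [set y + u | u in S].
  by move=> Sx; apply/seteqP; split=> _ [u /[dup] Su /Sx/IHx ux <-]; exists u; rewrite // ux.
have ey (S : set No) : (forall v, S v -> simpler v y) ->
    [set x + v | v in S] = [set v + x | v in S].
  by move=> Sy; apply/seteqP; split=> _ [v /[dup] Sv /Sy/IHy vy <-]; exists v; rewrite // vy.
by rewrite [LHS]No_addE [RHS]No_addE !ex ?ey => [|u []|u []|u []|u []] //; congr cut; rewrite setUC.
Qed.

(** An option of the inner sum is dominated by that sum with one argument replaced by an option,
    where the induction hypothesis applies. *)
Lemma No_addA : associative No_add.
Proof.
elim/(well_founded_ind simpler_wf) => x IHx; elim/(well_founded_ind simpler_wf) => y IHy.
elim/(well_founded_ind simpler_wf) => z IHz.
rewrite [LHS]No_addE [RHS]No_addE; apply: cut_eq_cut; rewrite -No_addE; split=> w.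
- case=> -[u xu <-].
    by rewrite (IHx _ xu.1); apply/No_lt_add2r/No_lt_add2r; exact: xu.2.
  have [[v yv /(No_le_add2l x)ule]|[v zv /(No_le_add2l x)ule]] := lopt_add xu.
    apply: le_lt_trans ule _; rewrite (IHy _ yv.1).
    by apply/No_lt_add2r/No_lt_add2l; exact: yv.2.
  apply: le_lt_trans ule _; rewrite (IHz _ zv.1).
  by apply/No_lt_add2l; exact: zv.2.
- case=> -[u xu <-].
    by rewrite (IHx _ xu.1); apply/No_lt_add2r/No_lt_add2r; exact: xu.2.
  have [[v yv /(No_le_add2l x)ule]|[v zv /(No_le_add2l x)ule]] := ropt_add xu.
    apply: lt_le_trans ule; rewrite (IHy _ yv.1).
    by apply/No_lt_add2r/No_lt_add2l; exact: yv.2.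
  apply: lt_le_trans ule; rewrite (IHz _ zv.1).
  by apply/No_lt_add2l; exact: zv.2.
- case=> -[u xu <-]; last first.
    by rewrite -(IHz _ xu.1); apply/No_lt_add2l/No_lt_add2l; exact: xu.2.
  have [[v yv /(No_le_add2r z)ule]|[v zv /(No_le_add2r z)ule]] := lopt_add xu.
    apply: le_lt_trans ule _; rewrite -(IHx _ yv.1).
    by apply/No_lt_add2r; exact: yv.2.
  apply: le_lt_trans ule _; rewrite -(IHy _ zv.1).
  by apply/No_lt_add2l/No_lt_add2r; exact: zv.2.
- case=> -[u xu <-]; last first.
    by rewrite -(IHz _ xu.1); apply/No_lt_add2l/No_lt_add2l; exact: xu.2.
  have [[v yv /(No_le_add2r z)ule]|[v zv /(No_le_add2r z)ule]] := ropt_add xu.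
    apply: lt_le_trans ule; rewrite -(IHx _ yv.1).
    by apply/No_lt_add2r; exact: yv.2.
  apply: lt_le_trans ule; rewrite -(IHy _ zv.1).
  by apply/No_lt_add2l/No_lt_add2r; exact: zv.2.
Qed.

Lemma cut_opt x : cut (lopt x) (ropt x) = x.
Proof.
apply: cut_eq => [|w wx [lw rw]]; first by split=> u [].
have [xw|xw|xw] := ltgtP x w; last by apply: (@simpler_irr w); rewrite -{2}xw.
  by have := rw w (conj wx xw); rewrite ltxx.
by have := lw w (conj wx xw); rewrite ltxx.
Qed.

Lemma lopt_No0 : lopt No0 = set0.
Proof. by apply/seteqP; split=> // x /lopt_No_ord[b]; rewrite On_lt0. Qed.

Lemma ropt_No0 : ropt No0 = set0.
Proof. exact: ropt_No_ord. Qed.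

Lemma No_add0 : left_id No0 No_add.
Proof.
elim/(well_founded_ind simpler_wf) => x IHx.
have ex (S : set No) : (forall u, S u -> simpler u x) -> [set No0 + u | u in S] = S.
  move=> Sx; apply/seteqP; split=> [_ [u /[dup] Su /Sx/IHx-> <-]//|u Su].
  by exists u => //; exact/IHx/Sx.
rewrite No_addE lopt_No0 ropt_No0 !image_set0 !set0U !ex; last 2 first.
  by move=> u [].
  by move=> u [].
exact: cut_opt.
Qed.

(** Exchanging the signs reverses the order and preserves simplicity, so it satisfies Conway's
    equation for the negative. *)
Lemma No_opp_flip x : - x = flip x.
Proof.
elim/(well_founded_ind simpler_wf): x => x IHx; rewrite No_oppE.
have ex (S : set No) : (forall u, S u -> simpler u x) ->
    [set - u | u in S] = [set flip u | u in S].
  by move=> Sx; apply/seteqP; split=> _ [u /[dup] Su /Sx/IHx ux <-]; exists u; rewrite // ux.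
rewrite !ex; last 2 first.
  by move=> u [].
  by move=> u [].
apply: cut_eq => [|w wx [lw rw]].
  by split=> _ [u [_ ux] <-]; rewrite flip_lt.
have fwx : simpler (flip w) x by rewrite -[x]flipK; exact: flip_simpler.
have [xw|xw|xw] := ltgtP x (flip w); last by apply: (@simpler_irr x); rewrite {1}xw.
  by have := lw w; rewrite ltxx => /(_ (ex_intro2 _ _ (flip w) (conj fwx xw) (flipK w))).
by have := rw w; rewrite ltxx => /(_ (ex_intro2 _ _ (flip w) (conj fwx xw) (flipK w))).
Qed.

Lemma No_lt_opp2 x y : (- x < - y) = (y < x).
Proof. by rewrite !No_opp_flip flip_lt. Qed.

(** Nothing is simpler than 0, so it is enough that the left options are negative and the right ones
    positive. *)
Lemma No_addN : left_inverse No0 No_opp No_add.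
Proof.
move=> x; rewrite No_opp_flip; elim/(well_founded_ind simpler_wf): x => x IHx.
rewrite No_addE; apply: cut_eq => [|w]; last by move/simpler_No_ord=> [b]; rewrite On_lt0.
have fopt u : simpler u (flip x) -> exists2 v, simpler v x & u = flip v.
  move=> ux; exists (flip u); last by rewrite flipK.
  by rewrite -[x]flipK; exact: flip_simpler.
split=> _ [[u [+ ux] <-]|[u [us ux] <-]].
- move=> /fopt[v vx euv]; rewrite euv -(IHx v vx); apply: No_lt_add2l.
  by rewrite -flip_lt -euv.
- by rewrite -(IHx u us); apply: No_lt_add2r; rewrite flip_lt.
- move=> /fopt[v vx euv]; rewrite euv -(IHx v vx); apply: No_lt_add2l.
  by rewrite -flip_lt -euv.
- by rewrite -(IHx u us); apply: No_lt_add2r; rewrite flip_lt.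
Qed.

HB.instance Definition _ := GRing.isZmodule.Build No No_addA No_addC No_add0 No_addN.

Close Scope No_scope.

Lemma No_addE_ring (x y : No) : (x + y)%No = (x + y)%R. Proof. by []. Qed.

Lemma No_ltD2r (z x y : No) : ((x + z)%R < (y + z)%R) = (x < y).
Proof.
apply/idP/idP; last exact: No_lt_add2r.
by move=> /(No_lt_add2r (- z)%R); rewrite !No_addE_ring !addrK.
Qed.

Lemma No_ltD2l (z x y : No) : ((z + x)%R < (z + y)%R) = (x < y).
Proof. by rewrite ![(z + _)%R]addrC No_ltD2r. Qed.

Lemma No_leD2r (z x y : No) : ((x + z)%R <= (y + z)%R) = (x <= y).
Proof. by rewrite !leNgt No_ltD2r. Qed.

Lemma No_leD2l (z x y : No) : ((z + x)%R <= (z + y)%R) = (x <= y).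
Proof. by rewrite !leNgt No_ltD2l. Qed.

Lemma No_leD (x y z t : No) : x <= y -> z <= t -> (x + z)%R <= (y + t)%R.
Proof. by move=> xy zt; apply: (@le_trans _ _ (y + z)%R); rewrite ?No_leD2r ?No_leD2l. Qed.

Lemma No_ltD (x y z t : No) : x < y -> z < t -> (x + z)%R < (y + t)%R.
Proof. by move=> xy zt; apply: (@lt_trans _ _ (y + z)%R); rewrite ?No_ltD2r ?No_ltD2l. Qed.

Lemma No_ltBB (a b c d : No) : ((a - b)%R < (c - d)%R) = ((a + d)%R < (c + b)%R).
Proof. by rewrite -(No_ltD2r (b + d)%R) addrA subrK [(b + d)%R]addrC addrA subrK. Qed.

Lemma No_ltBl (a b c : No) : ((a - b)%R < c) = (a < (c + b)%R).
Proof. by rewrite -(No_ltD2r b) subrK. Qed.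

Lemma No_ltBr (a b c : No) : (c < (a - b)%R) = ((c + b)%R < a).
Proof. by rewrite -(No_ltD2r b) subrK. Qed.

(** * Multiplication *)

Local Notation "x ** y" := (No_mul x y) (at level 40, left associativity).

Definition mulopt (x y u v : No) : No := (u ** y + x ** v - u ** v)%R.

Definition same_side (x y u v : No) := (u < x /\ v < y) \/ (x < u /\ y < v).
Definition opp_side (x y u v : No) := (u < x /\ y < v) \/ (x < u /\ v < y).

Definition mulopts (side : No -> No -> No -> No -> Prop) (x y : No) : set No :=
  [set z | exists u v, [/\ simpler u x, simpler v y, side x y u v & z = mulopt x y u v]].

Lemma No_mul_cutE x y : x ** y = cut (mulopts same_side x y) (mulopts opp_side x y).
Proof.
rewrite No_mulE; congr cut; apply/seteqP; split=> z.
- by case=> -[u [ux lu]] [v [vy lv]] <-; exists u, v; split=> //; [left|right].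
- by case=> u [v [ux vy [[lu lv]|[lu lv]] ->]]; [left|right]; exists u => //; exists v.
- by case=> -[u [ux lu]] [v [vy lv]] <-; exists u, v; split=> //; [left|right].
- by case=> u [v [ux vy [[lu lv]|[lu lv]] ->]]; [left|right]; exists u => //; exists v.
Qed.

Lemma No_mulC : commutative No_mul.
Proof.
elim/(well_founded_ind simpler_wf) => x IHx; elim/(well_founded_ind simpler_wf) => y IHy.
have optC u v : simpler u x -> simpler v y -> mulopt x y u v = mulopt y x v u.
  by move=> ux vy; rewrite /mulopt (IHx _ ux) (IHx _ ux) (IHy _ vy) [(y ** u + _)%R]addrC.
rewrite !No_mul_cutE; congr cut; apply/seteqP; split=> z [u [v [us vs side ->]]].
- by exists v, u; split=> //; [case: side => -[]; [left|right]|exact: optC].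
- by exists v, u; split=> //; [case: side => -[]; [left|right]|rewrite optC].
- by exists v, u; split=> //; [case: side => -[]; [right|left]|exact: optC].
- by exists v, u; split=> //; [case: side => -[]; [right|left]|rewrite optC].
Qed.

Lemma muloptC x y u v : mulopt x y u v = mulopt y x v u.
Proof.
rewrite /mulopt [(u ** y + _)%R]addrC [x ** v]No_mulC [u ** y]No_mulC.
by rewrite [u ** v]No_mulC.
Qed.

Definition mul_between x y := between (mulopts same_side x y) (mulopts opp_side x y) (x ** y).

(** [(x2 - x1) * (y2 - y1) > 0], expanded. *)
Definition mul_rect (x1 x2 y1 y2 : No) : Prop :=
  (x1 ** y2 + x2 ** y1)%R < (x1 ** y1 + x2 ** y2)%R.

Lemma mul_rectC x1 x2 y1 y2 : mul_rect x1 x2 y1 y2 -> mul_rect y1 y2 x1 x2.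
Proof.
rewrite /mul_rect [y1 ** x2]No_mulC [y2 ** x1]No_mulC [y1 ** _]No_mulC [y2 ** _]No_mulC.
by rewrite [(x2 ** y1 + _)%R]addrC.
Qed.

(** Comparing x * y with an option of one of Conway's four kinds is the positivity of the rectangle
    spanned by (u, v) and (x, y); the kind fixes the orientation. *)
Lemma mul_rect_option x y u v : mul_between x y -> simpler u x -> simpler v y ->
  [/\ u < x -> v < y -> mul_rect u x v y, x < u -> v < y -> mul_rect x u v y,
      u < x -> y < v -> mul_rect u x y v & x < u -> y < v -> mul_rect x u y v].
Proof.
move=> [lt_ gt_] us vs.
have {}lt_ : same_side x y u v -> (u ** y + x ** v)%R < (x ** y + u ** v)%R.
  by move=> side; rewrite -No_ltBl; apply: lt_; exists u, v.
have {}gt_ : opp_side x y u v -> (x ** y + u ** v)%R < (u ** y + x ** v)%R.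
  by move=> side; rewrite -No_ltBr; apply: gt_; exists u, v.
split=> ux vy; rewrite /mul_rect.
- by rewrite [(u ** v + _)%R]addrC; apply: lt_; left.
- by rewrite [ltRHS]addrC; apply: gt_; right.
- by rewrite [ltLHS]addrC; apply: gt_; left.
- by rewrite [ltLHS]addrC; apply: lt_; right.
Qed.

Lemma simpler_comparable x u w : No_prefix u x -> No_prefix w x -> u < w ->
  simpler u w \/ simpler w u.
Proof.
move=> ux wx uw; have uNw : u <> w by move=> e; rewrite e ltxx in uw.
by have [p|p] := simpler_prefix_total ux wx; [left|right; split=> //; exact: nesym].
Qed.

(** In each coordinate one end is simpler than the other. At the corner formed by the two less
    simple ends, the two simpler ones give an option, and its inequality is the claim. *)
Lemma mul_rect_comparable x1 x2 y1 y2 x y :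
  No_prefix x1 x -> No_prefix x2 x -> No_prefix y1 y -> No_prefix y2 y ->
  x1 < x2 -> y1 < y2 ->
  mul_between x1 y1 -> mul_between x1 y2 -> mul_between x2 y1 -> mul_between x2 y2 ->
  mul_rect x1 x2 y1 y2.
Proof.
move=> px1 px2 py1 py2 lx ly b11 b12 b21 b22.
have [sx|sx] := simpler_comparable px1 px2 lx; have [sy|sy] := simpler_comparable py1 py2 ly.
- by have [+ _ _ _] := mul_rect_option b22 sx sy; exact.
- by have [_ _ + _] := mul_rect_option b21 sx sy; exact.
- by have [_ + _ _] := mul_rect_option b12 sx sy; exact.
- by have [_ _ _ +] := mul_rect_option b11 sx sy; exact.
Qed.

Lemma mulopt_ltr x y u v w : mul_rect u x v w -> mulopt x y u v < mulopt x y u w.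
Proof.
by rewrite /mulopt No_ltBB -!addrA No_ltD2l [(x ** v + _)%R]addrC [(x ** w + _)%R]addrC.
Qed.

Lemma mulopt_gtr x y u v w : mul_rect x u v w -> mulopt x y u w < mulopt x y u v.
Proof. by rewrite /mulopt No_ltBB -!addrA No_ltD2l. Qed.

Lemma mulopt_ltl x y u w v : mul_rect u w v y -> mulopt x y u v < mulopt x y w v.
Proof. by move=> /mul_rectC r; rewrite ![mulopt x y _ _]muloptC; exact: mulopt_ltr. Qed.

Lemma mulopt_gtl x y u w v : mul_rect u w y v -> mulopt x y w v < mulopt x y u v.
Proof. by move=> /mul_rectC r; rewrite ![mulopt x y _ _]muloptC; exact: mulopt_gtr. Qed.

Lemma mul_betweenC x y : mul_between x y -> mul_between y x.
Proof.
rewrite /mul_between No_mulC => -[lt_ gt_]; split=> _ [u [v [us vs side ->]]]; rewrite muloptC.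
  by apply: lt_; exists v, u; split=> //; case: side => -[]; [left|right].
by apply: gt_; exists v, u; split=> //; case: side => -[]; [right|left].
Qed.

(** One coordinate is changed at a time, the order of [u] and [w] deciding which comes first. Each
    change is a rectangle none of whose corners is (x, y), so [IH] covers all four. *)
Lemma mulopt_lt_mulopt x y :
  (forall u v, No_prefix u x -> No_prefix v y -> simpler u x \/ simpler v y -> mul_between u v) ->
  forall u w v v', simpler u x -> simpler w x -> simpler v y -> simpler v' y ->
  [/\ u < x, w < x, v < y & y < v'] \/ [/\ x < u, x < w, y < v & v' < y] ->
  mulopt x y u v < mulopt x y w v'.
Proof.
move=> IH u w v v' us ws vs vs'; have px : No_prefix x x by []; have py : No_prefix y y by [].
have rect x1 x2 y1 y2 :
    No_prefix x1 x -> No_prefix x2 x -> No_prefix y1 y -> No_prefix y2 y ->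
    simpler x1 x /\ simpler x2 x \/ simpler y1 y /\ simpler y2 y ->
    x1 < x2 -> y1 < y2 -> mul_rect x1 x2 y1 y2.
  move=> px1 px2 py1 py2 s12 lx ly.
  by apply: (mul_rect_comparable px1 px2 py1 py2) => //; apply: IH => //;
    case: s12 => -[]; [left|right|left|right|left|right|left|right].
have [pu pw pv pv'] := And4 us.2 ws.2 vs.2 vs'.2.
case=> -[ux wx vy vy'].
  have vert t : simpler t x -> t < x -> mulopt x y t v < mulopt x y t v'.
    move=> ts tx; apply/mulopt_ltr/rect => //; [exact: ts.2|by right|exact: lt_trans vy'].
  have [uw|wu|->] := ltgtP u w; last exact: vert.
    apply: lt_trans (vert w ws wx); apply/mulopt_ltl/rect => //; by left.
  apply: lt_trans (vert u us ux) _; apply/mulopt_gtl/rect => //; by left.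
have vert t : simpler t x -> x < t -> mulopt x y t v < mulopt x y t v'.
  move=> ts tx; apply/mulopt_gtr/rect => //; [exact: ts.2|by right|exact: lt_trans vy].
have [uw|wu|->] := ltgtP u w; last exact: vert.
  apply: lt_trans (vert u us ux) _; apply/mulopt_ltl/rect => //; by left.
apply: lt_trans (vert w ws wx); apply/mulopt_gtl/rect => //; by left.
Qed.

Lemma mulopts_bounded side x y : bounded_len (mulopts side x y).
Proof.
apply: (@bounded_len_sub _ [set z | exists2 u, simpler u x &
    [set mulopt x y u v | v in [set v | simpler v y]] z]).
  by move=> _ [u [v [us vs _ ->]]]; exists u => //; exists v.
by apply: bounded_len_simpler => u _; apply: (@bounded_len_image _ y).
Qed.

Lemma mul_betweenP x y : between (mulopts same_side x y) (mulopts opp_side x y) !=set0.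
Proof.
suff [] : between (mulopts same_side x y) (mulopts opp_side x y) !=set0 /\ mul_between x y by [].
elim/(well_founded_ind simpler_wf): x y => x IHx.
elim/(well_founded_ind simpler_wf) => y IHy.
suff ne : between (mulopts same_side x y) (mulopts opp_side x y) !=set0.
  by split=> //; rewrite /mul_between No_mul_cutE; exact: cut_between.
have IH u v : No_prefix u x -> No_prefix v y -> simpler u x \/ simpler v y -> mul_between u v.
  move=> pu pv [/IHx/(_ v)[]//|vs]; have [->|/IHx/(_ v)[]//] := prefix_simpler pu.
  by have [] := IHy v vs.
have IH' v u : No_prefix v y -> No_prefix u x -> simpler v y \/ simpler u x -> mul_between v u.
  by move=> pv pu svu; apply: mul_betweenC; apply: IH => //; case: svu; [right|left].
apply: between_nonempty; [exact: mulopts_bounded|exact: mulopts_bounded|].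
move=> _ _ [u [v [us vs side ->]]] [w [v' [ws vs' side' ->]]].
case: side side' => -[ux vy] [[wx vy']|[wx vy']].
- by apply: mulopt_lt_mulopt => //; left.
- by rewrite ![mulopt x y _ _]muloptC; apply: mulopt_lt_mulopt => //; left.
- by rewrite ![mulopt x y _ _]muloptC; apply: mulopt_lt_mulopt => //; right.
- by apply: mulopt_lt_mulopt => //; right.
Qed.

Lemma No_mul_between x y : mul_between x y.
Proof. rewrite /mul_between No_mul_cutE; exact/cut_between/mul_betweenP. Qed.

Lemma lopt_mul x y w : lopt (x ** y) w ->
  exists u v, [/\ simpler u x, simpler v y, same_side x y u v & w <= mulopt x y u v].
Proof.
rewrite No_mul_cutE => /lopt_cut[|_ [u [v [us vs side ->]]]]; first exact: mul_betweenP.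
by exists u, v.
Qed.

Lemma ropt_mul x y w : ropt (x ** y) w ->
  exists u v, [/\ simpler u x, simpler v y, opp_side x y u v & mulopt x y u v <= w].
Proof.
rewrite No_mul_cutE => /ropt_cut[|_ [u [v [us vs side ->]]]]; first exact: mul_betweenP.
by exists u, v.
Qed.

(** [No_homo] is used twice: in the first coordinate, for second coordinates comparable by
    simplicity, and then in the second coordinate. *)
Lemma mul_rect_lt x1 x2 y1 y2 : x1 < x2 -> y1 < y2 -> mul_rect x1 x2 y1 y2.
Proof.
have rectE a b c d : mul_rect a b c d <-> (a ** d - a ** c)%R < (b ** d - b ** c)%R.
  by rewrite /mul_rect No_ltBB [(b ** d + _)%R]addrC.
have rectE' a b c d : mul_rect a b c d <-> (b ** c - a ** c)%R < (b ** d - a ** d)%R.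
  by rewrite /mul_rect No_ltBB [(b ** c + _)%R]addrC [(b ** d + _)%R]addrC.
have step v y : simpler v y \/ simpler y v -> v < y -> x1 < x2 -> mul_rect x1 x2 v y.
  move=> vys vy x12; apply/rectE.
  apply: (@No_homo (fun x => (x ** y - x ** v)%R)) x12 => x u [us ux]; apply/rectE.
    case: vys => s; first by have [+ _ _ _] := mul_rect_option (No_mul_between x y) us s; exact.
    by have [_ _ + _] := mul_rect_option (No_mul_between x v) us s; exact.
  case: vys => s; first by have [_ + _ _] := mul_rect_option (No_mul_between x y) us s; exact.
  by have [_ _ _ +] := mul_rect_option (No_mul_between x v) us s; exact.
move=> x12 y12; apply/rectE'.
apply: (@No_homo (fun y => (x2 ** y - x1 ** y)%R)) y12 => y v [vs vy]; apply/rectE'; apply: step => //.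
  by left.
by right.
Qed.

(** Here [u] and [v] need not be simpler than [x] and [y]; distributivity applies this to v + z,
    which need not be simpler than y + z. *)
Lemma mulopt_same_side x y u v : same_side x y u v -> mulopt x y u v < x ** y.
Proof.
by case=> -[ux vy]; rewrite /mulopt No_ltBl; have := mul_rect_lt ux vy; rewrite /mul_rect;
  [rewrite [(u ** v + _)%R]addrC|rewrite [ltLHS]addrC].
Qed.

Lemma mulopt_opp_side x y u v : opp_side x y u v -> x ** y < mulopt x y u v.
Proof.
by case=> -[ux vy]; rewrite /mulopt No_ltBr; have := mul_rect_lt ux vy; rewrite /mul_rect;
  [rewrite [ltLHS]addrC|rewrite [ltRHS]addrC].
Qed.

Lemma mulopt_le_left x y u v w : u < x -> v <= w -> mulopt x y u v <= mulopt x y u w.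
Proof.
move=> ux; rewrite le_eqVlt => /orP[/eqP->//|vw]; exact/ltW/mulopt_ltr/mul_rect_lt.
Qed.

Lemma mulopt_le_right x y u v w : x < u -> v <= w -> mulopt x y u w <= mulopt x y u v.
Proof.
move=> ux; rewrite le_eqVlt => /orP[/eqP->//|vw]; exact/ltW/mulopt_gtr/mul_rect_lt.
Qed.

(** * Distributivity, unit and monotonicity of the product *)

Lemma mulopt_addl x y z u v :
  u ** (y + z)%R = (u ** y + u ** z)%R -> x ** (v + z)%R = (x ** v + x ** z)%R ->
  u ** (v + z)%R = (u ** v + u ** z)%R ->
  mulopt x (y + z)%R u (v + z)%R = (mulopt x y u v + x ** z)%R.
Proof.
move=> e1 e2 e3; rewrite /mulopt e1 e2 e3 opprD.
(* The rearrangement brings [u ** z] next to its opposite. *)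
rewrite (AC (2*2*2) (1*3*5*4*(2*6)))/= addrN addr0 //.
Qed.

Lemma same_side_addl x y z u v : same_side x y u v -> same_side x (y + z)%R u (v + z)%R.
Proof. by case=> -[? ?]; [left|right]; rewrite No_ltD2r. Qed.

Lemma opp_side_addl x y z u v : opp_side x y u v -> opp_side x (y + z)%R u (v + z)%R.
Proof. by case=> -[? ?]; [left|right]; rewrite No_ltD2r. Qed.

(** Half of the options occurring in the proof of distributivity; the other
    half follows by exchanging [y] and [z]. *)
Lemma mulDr_options x y z :
  (forall u, simpler u x -> u ** (y + z)%R = (u ** y + u ** z)%R) ->
  (forall v, simpler v y -> x ** (v + z)%R = (x ** v + x ** z)%R) ->
  (forall u v, simpler u x -> simpler v y -> u ** (v + z)%R = (u ** v + u ** z)%R) ->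
  [/\ forall u w v, lopt x u -> lopt y v -> w <= (v + z)%R ->
        mulopt x (y + z)%R u w < (x ** y + x ** z)%R,
      forall u w v, ropt x u -> ropt y v -> (v + z)%R <= w ->
        mulopt x (y + z)%R u w < (x ** y + x ** z)%R,
      forall u w v, lopt x u -> ropt y v -> (v + z)%R <= w ->
        (x ** y + x ** z)%R < mulopt x (y + z)%R u w &
      forall u w v, ropt x u -> lopt y v -> w <= (v + z)%R ->
        (x ** y + x ** z)%R < mulopt x (y + z)%R u w] /\
  (forall w, lopt (x ** y) w -> (w + x ** z)%R < x ** (y + z)%R) /\
  (forall w, ropt (x ** y) w -> x ** (y + z)%R < (w + x ** z)%R).
Proof.
move=> IHx IHy IHxy.
have optE u v : simpler u x -> simpler v y ->
    mulopt x (y + z)%R u (v + z)%R = (mulopt x y u v + x ** z)%R.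
  by move=> us vs; apply: mulopt_addl; [exact: IHx|exact: IHy|exact: IHxy].
split; first split.
- move=> u w v [us ux] [vs vy] wv; apply: le_lt_trans (mulopt_le_left _ ux wv) _.
  by rewrite optE // No_ltD2r; apply: mulopt_same_side; left.
- move=> u w v [us ux] [vs vy] wv; apply: le_lt_trans (mulopt_le_right _ ux wv) _.
  by rewrite optE // No_ltD2r; apply: mulopt_same_side; right.
- move=> u w v [us ux] [vs vy] wv; apply: lt_le_trans (mulopt_le_left _ ux wv).
  by rewrite optE // No_ltD2r; apply: mulopt_opp_side; left.
- move=> u w v [us ux] [vs vy] wv; apply: lt_le_trans (mulopt_le_right _ ux wv).
  by rewrite optE // No_ltD2r; apply: mulopt_opp_side; right.
split=> w.
  move=> /lopt_mul[u [v [us vs side wle]]].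
  apply: (@le_lt_trans _ _ (mulopt x y u v + x ** z)%R); first by rewrite No_leD2r.
  by rewrite -optE //; exact/mulopt_same_side/same_side_addl.
move=> /ropt_mul[u [v [us vs side wle]]].
apply: (@lt_le_trans _ _ (mulopt x y u v + x ** z)%R); last by rewrite No_leD2r.
by rewrite -optE //; exact/mulopt_opp_side/opp_side_addl.
Qed.

(** An option of the product on the left involves an option of y + z, which is dominated by v + z or
    y + v for an option v of y or z. After this replacement the induction hypotheses split off the
    term that does not change. *)
Lemma No_mulDr x y z : x ** (y + z)%R = (x ** y + x ** z)%R.
Proof.
elim/(well_founded_ind simpler_wf): x y z => x IHx.
elim/(well_founded_ind simpler_wf) => y IHy; elim/(well_founded_ind simpler_wf) => z IHz.
have [[yLL yRR yLR yRL] [yl yr]] := @mulDr_options x y z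
  (fun u us => IHx u us y z) (fun v vs => IHy v vs z) (fun u v us vs => IHx u us v z).
have [|v vs|u v us vs|[zLL zRR zLR zRL] [zl zr]] := @mulDr_options x z y.
- by move=> u us; rewrite addrC [RHS]addrC; exact: IHx.
- by rewrite addrC [RHS]addrC; exact: IHz.
- by rewrite addrC [RHS]addrC; exact: IHx.
rewrite ![(z + y)%R]addrC ![(x ** z + x ** y)%R]addrC in zLL zRR zLR zRL zl zr.
rewrite [LHS]No_mul_cutE -[RHS]No_addE_ring [RHS]No_addE; apply: cut_eq_cut.
  rewrite -No_addE; split=> _ [u [w [us ws [[ux wyz]|[ux wyz]] ->]]].
  - have [[v yv wv]|[v zv wv]] := lopt_add (conj ws wyz); first exact: (yLL _ _ v).
    by rewrite No_addE_ring addrC in wv; exact: (zLL _ _ v).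
  - have [[v yv wv]|[v zv wv]] := ropt_add (conj ws wyz); first exact: (yRR _ _ v).
    by rewrite No_addE_ring addrC in wv; exact: (zRR _ _ v).
  - have [[v yv wv]|[v zv wv]] := ropt_add (conj ws wyz); first exact: (yLR _ _ v).
    by rewrite No_addE_ring addrC in wv; exact: (zLR _ _ v).
  - have [[v yv wv]|[v zv wv]] := lopt_add (conj ws wyz); first exact: (yRL _ _ v).
    by rewrite No_addE_ring addrC in wv; exact: (zRL _ _ v).
rewrite -No_mul_cutE; split=> _ [[w ww <-]|[w ww <-]]; rewrite No_addE_ring.
- exact: yl.
- by rewrite addrC; exact: zl.
- exact: yr.
- by rewrite [ltRHS]addrC; exact: zr.
Qed.

Lemma No_mulr0 x : x ** 0%R = 0%R.
Proof. by apply: (@addrI _ (x ** 0%R)); rewrite -No_mulDr !addr0. Qed.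

Lemma No_mul0r x : 0%R ** x = 0%R.
Proof. by rewrite No_mulC No_mulr0. Qed.

Lemma No_mulrN x y : x ** (- y)%R = (- (x ** y))%R.
Proof. by apply: (@addrI _ (x ** y)); rewrite -No_mulDr !addrN No_mulr0. Qed.

Lemma No_mulNr x y : (- x)%R ** y = (- (x ** y))%R.
Proof. by rewrite No_mulC No_mulrN No_mulC. Qed.

(** Only 0 is simpler than 1, and the option formed from u and 0 is u itself. *)
Lemma No_mulr1 x : x ** No1 = x.
Proof.
elim/(well_founded_ind simpler_wf): x => x IHx; rewrite -[RHS]cut_opt No_mul_cutE.
have opt0 u : simpler u x -> mulopt x No1 u 0%R = u.
  by move=> us; rewrite /mulopt IHx // !No_mulr0 subr0 addr0.
have simpler1 v : simpler v No1 -> v = 0%R.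
  by move=> /simpler_No_ord[b]; rewrite On_lt1 => /eqP->.
have lt01 : (0 : No)%R < No1 by rewrite No_ord_lt On_lt_succ.
congr cut; apply/seteqP; split=> w.
- move=> [u [v [us /simpler1-> [[ux _]|[_ n1]] ->]]]; first by rewrite opt0.
  by have := lt_trans lt01 n1; rewrite ltxx.
- move=> [ws wx]; exists w, 0%R; split; rewrite ?opt0 //; last by left.
  by apply/simpler_No_ord; exists On0; rewrite ?On_lt_succ.
- move=> [u [v [us /simpler1-> [[_ n1]|[ux _]] ->]]]; last by rewrite opt0.
  by have := lt_trans lt01 n1; rewrite ltxx.
- move=> [ws wx]; exists w, 0%R; split; rewrite ?opt0 //; last by right.
  by apply/simpler_No_ord; exists On0; rewrite ?On_lt_succ.
Qed.

Lemma No_mul_gt0 x y : No0 < x -> No0 < y -> No0 < x ** y.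
Proof.
by move=> x0 y0; have := @mul_rect_lt 0%R x 0%R y x0 y0; rewrite /mul_rect !No_mul0r No_mulr0 !add0r.
Qed.

Lemma No_mul_ge0 x y : No0 <= x -> No0 <= y -> No0 <= x ** y.
Proof.
rewrite le_eqVlt => /orP[/eqP<-|x0]; first by rewrite No_mul0r.
rewrite le_eqVlt => /orP[/eqP<-|y0]; first by rewrite No_mulr0.
exact/ltW/No_mul_gt0.
Qed.

Lemma No_ler_M2l x y z : No0 <= x -> y <= z -> x ** y <= x ** z.
Proof.
move=> x0 yz; rewrite -(No_leD2r (- (x ** y))%R) addrN -No_mulrN -No_mulDr.
by apply: No_mul_ge0 => //; rewrite -(No_leD2r y) [(No0 + y)%R]add0r subrK.
Qed.

Lemma No_ler_M x y z t : No0 <= x -> No0 <= t -> x <= y -> z <= t -> x ** z <= y ** t.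
Proof.
move=> x0 t0 xy zt; apply: le_trans (No_ler_M2l x0 zt) _.
by rewrite ![_ ** t]No_mulC; exact: No_ler_M2l.
Qed.

(** * Sums and products of ordinals *)

Lemma addR_No_ord a b : addR (No_ord a) (No_ord b) = set0.
Proof. by rewrite /addR !ropt_No_ord !image_set0 setU0. Qed.

Lemma No_ordD a b : exists c, (No_ord a + No_ord b)%R = No_ord c.
Proof.
rewrite -[(_ + _)%R]/(No_ord a + No_ord b)%No No_addE.
rewrite -[X in cut _ X]/(addR (No_ord a) (No_ord b)) addR_No_ord; apply: cut_No_ord.
by apply: bounded_lenU; [apply: (@bounded_len_image _ (No_ord a))|
  apply: (@bounded_len_image _ (No_ord b))] => u [].
Qed.

Lemma opp_side_No_ord a b : mulopts opp_side (No_ord a) (No_ord b) = set0.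
Proof.
apply/seteqP; split=> // z [u [v [/simpler_No_ord[c ca uc] /simpler_No_ord[d db vd] + _]]].
rewrite uc vd => -[[_]|[+ _]]; rewrite No_ord_lt ltNge; first by rewrite (ltW db).
by rewrite (ltW ca).
Qed.

Lemma No_ordM a b : exists c, No_ord a ** No_ord b = No_ord c.
Proof.
rewrite No_mul_cutE opp_side_No_ord; apply: cut_No_ord; exact: mulopts_bounded.
Qed.

Lemma cut_le_No_ord L d : between L set0 (No_ord d) -> cut L set0 <= No_ord d.
Proof.
case/cut_simplest => [->//|[_ p]]; rewrite (prefix_No_ord p) No_ord_le -[leRHS]len_No_ord.
exact: prefix_len.
Qed.

Lemma No_ordD_le a b d :
  (forall c, c < a -> (No_ord c + No_ord b)%R < No_ord d) ->
  (forall c, c < b -> (No_ord a + No_ord c)%R < No_ord d) ->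
  (No_ord a + No_ord b)%R <= No_ord d.
Proof.
move=> ad bd; rewrite -[(_ + _)%R]/(No_ord a + No_ord b)%No No_addE.
rewrite -[X in cut _ X]/(addR (No_ord a) (No_ord b)) addR_No_ord; apply: cut_le_No_ord; split=> // z.
by case=> -[u /lopt_No_ord[c cx ->] <-]; [exact: ad|exact: bd].
Qed.

Lemma No_ordS a : No_ord (On_succ a) = (No_ord a + No1)%R.
Proof.
have lt1 : (0 : No)%R < No1 by rewrite No_ord_lt On_lt_succ.
elim/(well_founded_ind On_lt_wf): a => a IH; apply/le_anti/andP; split.
  have [e e_def] := No_ordD a On1; rewrite [leRHS]e_def No_ord_le On_succ_le -No_ord_lt -e_def.
  by rewrite -{1}[No_ord a]addr0 No_ltD2l.
apply: No_ordD_le => c; first by move=> ca; rewrite -[No_ord On1]/No1 -IH // No_ord_lt On_lt_succE On_succ_le.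
by rewrite On_lt1 => /eqP->; rewrite [(_ + _)%R]addr0 No_ord_lt On_lt_succ.
Qed.

Lemma No_ord_ge0 a : No0 <= No_ord a.
Proof. by rewrite No_ord_le On0_le. Qed.

(** The surreal sum is at least a and strictly increasing in b; the ordinal sum is the least
    function with these properties. *)
Lemma On_add_le_No a b : No_ord (On_add a b) <= (No_ord a + No_ord b)%R.
Proof.
elim/(well_founded_ind On_lt_wf): b => b IH; have [e e_def] := No_ordD a b.
rewrite e_def No_ord_le; apply/On_add_leP; split.
  by rewrite -No_ord_le -e_def -{1}[No_ord a]addr0 No_leD2l; exact: No_ord_ge0.
by move=> c cb; rewrite -No_ord_lt -e_def (le_lt_trans (IH _ cb)) // No_ltD2l No_ord_lt.
Qed.

Lemma On_mul_le_No a b : No_ord (On_mul a b) <= No_ord a ** No_ord b.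
Proof.
elim/(well_founded_ind On_lt_wf): b => b IH; have [e e_def] := No_ordM a b.
rewrite e_def No_ord_le; apply/On_mul_leP => c cb; rewrite -No_ord_le -e_def.
apply: le_trans (On_add_le_No _ _) _.
apply: (@le_trans _ _ (No_ord a ** No_ord c + No_ord a)%R); first by rewrite No_leD2r; exact: IH.
rewrite -{2}[No_ord a]No_mulr1 -No_mulDr; apply: No_ler_M2l; first exact: No_ord_ge0.
by rewrite -No_ordS No_ord_le On_succ_le.
Qed.

(** * Powers of omega under the Hessenberg operations *)

Definition nadd_closed (g : On) : Prop :=
  forall a b, a < g -> b < g -> (No_ord a + No_ord b)%R < No_ord g.

(** Terms do not mix when g is closed under the Hessenberg sum. The range x <= g includes g itself,
    which is the value used to pass from n to n + 1. *)
Lemma nadd_closed_mul_nat g n x : On0 < g -> nadd_closed g -> x <= g ->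
  (No_ord (On_mul g (On_nat n)) + No_ord x)%R <= No_ord (On_add (On_mul g (On_nat n)) x).
Proof.
move=> g0 gD; elim: n x => [|n IHn] x.
  by move=> _; rewrite /= On_mulr0 [(No_ord On0 + _)%R]add0r No_ord_le On_le_addr.
rewrite /= On_mulrS; set gn := On_mul g _ in IHn *; set u := On_add gn g.
elim/(well_founded_ind On_lt_wf): x => x IHx xg; apply: No_ordD_le => c; last first.
  move=> cx; apply: le_lt_trans (IHx c cx (le_trans (ltW cx) xg)) _.
  by rewrite No_ord_lt On_ltD2l.
move=> cu; have [d dg cd] : exists2 d, d < g & c <= On_add gn d.
  have [cgn|//] := On_lt_addP cu; exists On0 => //.
  by rewrite On_addr0 ltW.
apply: (@le_lt_trans _ _ (No_ord gn + No_ord d + No_ord x)%R).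
  by rewrite No_leD2r (le_trans _ (On_add_le_No _ _)) // No_ord_le.
(* If x = g, this copy of g joins [gn] by induction on n, and the rest d < x is added by induction
   on x. If x < g, the Hessenberg sum of d and x stays below g. *)
move: xg; rewrite le_eqVlt => /orP[/eqP xg|xg].
  rewrite addrAC; apply: (@le_lt_trans _ _ (No_ord u + No_ord d)%R).
    by rewrite No_leD2r xg; exact: IHn.
  apply: (@le_lt_trans _ _ (No_ord (On_add u d))); first by apply: IHx; rewrite ?xg // ltW.
  by rewrite No_ord_lt xg On_ltD2l.
rewrite -addrA; apply: (@lt_le_trans _ _ (No_ord gn + No_ord g)%R).
  by rewrite No_ltD2l; exact: gD.
by apply: le_trans (IHn _ (lexx _)) _; rewrite No_ord_le On_le_addl.
Qed.

(** Identifies ordinal multiples of g with multiples in the additive group, where they can be added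
    freely. *)
Lemma nadd_closed_mulrn g n : On0 < g -> nadd_closed g ->
  (No_ord g *+ n)%R = No_ord (On_mul g (On_nat n)).
Proof.
move=> g0 gD; elim: n => [|n IHn]; first by rewrite mulr0n On_mulr0.
rewrite mulrSr IHn /= On_mulrS; apply/le_anti; rewrite On_add_le_No andbT.
exact: nadd_closed_mul_nat.
Qed.

Lemma nadd_closed_mulrn_lt g n : On0 < g -> nadd_closed g ->
  (No_ord g *+ n)%R < No_ord (On_mul g On_omega).
Proof. by move=> g0 gD; rewrite nadd_closed_mulrn // No_ord_lt On_mul_nat_lt_omega. Qed.

Lemma lt_mul_omega_mulrn g x : On0 < g -> nadd_closed g -> x < On_mul g On_omega ->
  exists n, No_ord x <= (No_ord g *+ n)%R.
Proof.
move=> g0 gD /On_lt_mulP[_ /On_lt_omegaP[n ->] xn]; exists n.+1.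
by rewrite nadd_closed_mulrn // No_ord_le /= On_mulrS ltW.
Qed.

Lemma nadd_closed_mul_omega g : On0 < g -> nadd_closed g -> nadd_closed (On_mul g On_omega).
Proof.
move=> g0 gD x y /(lt_mul_omega_mulrn g0 gD)[n xn] /(lt_mul_omega_mulrn g0 gD)[m ym].
by apply: le_lt_trans (No_leD xn ym) _; rewrite -mulrnDr nadd_closed_mulrn_lt.
Qed.

(** Both arguments lie below omega^e * omega, where e < b is the larger of two exponents, and this
    product inherits closure from omega^e. *)
Lemma nadd_closed_omega_pow b : nadd_closed (omega_pow b).
Proof.
elim/(well_founded_ind On_lt_wf): b => b IH x y xb yb.
case: (lt_omega_powP xb) => [->|[c cb xc]]; first by rewrite [(_ + _)%R]add0r No_ord_lt.
case: (lt_omega_powP yb) => [->|[d db yd]]; first by rewrite [(_ + _)%R]addr0 No_ord_lt.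
have [e [eb xe ye]] : exists e, [/\ e < b, x < On_mul (omega_pow e) On_omega
    & y < On_mul (omega_pow e) On_omega].
  have [cd|/ltW dc] := leP c d; [exists d|exists c]; split=> //.
    exact: lt_le_trans xc (On_leM2r _ (omega_pow_le cd)).
  exact: lt_le_trans yd (On_leM2r _ (omega_pow_le dc)).
apply: lt_le_trans (nadd_closed_mul_omega (omega_pow_gt0 e) (IH e eb) xe ye) _.
by rewrite No_ord_le omega_pow_mul_le.
Qed.

Lemma omega_pow_mulrn_lt b c n : c < b -> (No_ord (omega_pow c) *+ n)%R < No_ord (omega_pow b).
Proof.
move=> cb; apply: lt_le_trans (nadd_closed_mulrn_lt n (omega_pow_gt0 c) _) _.
  exact: nadd_closed_omega_pow.
by rewrite No_ord_le omega_pow_mul_le.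
Qed.

Lemma lt_omega_pow_mulrn b x : x < omega_pow b ->
  x = On0 \/ exists c n, c < b /\ No_ord x <= (No_ord (omega_pow c) *+ n)%R.
Proof.
move=> /lt_omega_powP[->|[c cb xc]]; [by left|right; exists c].
have [n xn] := lt_mul_omega_mulrn (omega_pow_gt0 c) (@nadd_closed_omega_pow c) xc.
by exists n.
Qed.

Lemma No_mulrnAr (x y : No) n : x ** (y *+ n)%R = (x ** y *+ n)%R.
Proof. by elim: n => [|n IH]; rewrite ?mulr0n ?No_mulr0 // !mulrS No_mulDr IH. Qed.

Lemma No_mulrnAl (x y : No) n : (x *+ n)%R ** y = (x ** y *+ n)%R.
Proof. by rewrite No_mulC No_mulrnAr No_mulC. Qed.

Lemma No_lerMn (x y : No) n : x <= y -> (x *+ n)%R <= (y *+ n)%R.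
Proof. by move=> xy; elim: n => [|n IH]; rewrite ?mulr0n // !mulrS No_leD. Qed.

Lemma No_mulrn_ge0 (x : No) n : No0 <= x -> No0 <= (x *+ n)%R.
Proof. by move=> /(No_lerMn n); rewrite mul0rn. Qed.

(** [omega ^ b * omega ^ c = omega ^ (b + c)] for the operations of [No];
    only the upper bound is needed. *)
Lemma omega_pow_mul_le_No b c d : (No_ord b + No_ord c)%R <= No_ord d ->
  No_ord (omega_pow b) ** No_ord (omega_pow c) <= No_ord (omega_pow d).
Proof.
elim/(well_founded_ind On_lt_wf): b c d => b IHb.
elim/(well_founded_ind On_lt_wf) => c IHc d bcd.
(* Stated for a fixed factor [z] so as to serve both arguments: u is bounded by a finite multiple of
   some omega^e with e < x, whose product with [z] the induction controls. *)
have half x y z u : (forall e, e < x -> exists2 f, f < d &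
      No_ord (omega_pow e) ** z <= No_ord (omega_pow f)) ->
    z = No_ord y -> u < omega_pow x -> No_ord u ** z < No_ord (omega_pow d).
  move=> IH z_def /lt_omega_pow_mulrn[->|[e [n [ex un]]]].
    by rewrite No_mul0r No_ord_lt omega_pow_gt0.
  have z0 : No0 <= z by rewrite z_def No_ord_ge0.
  have [f fd ef] := IH e ex; apply: le_lt_trans (omega_pow_mulrn_lt n fd).
  apply: le_trans (No_lerMn n ef); rewrite -No_mulrnAl ![_ ** z]No_mulC.
  exact: No_ler_M2l.
have {}half1 u : u < omega_pow b -> No_ord u ** No_ord (omega_pow c) < No_ord (omega_pow d).
  apply: half => // e eb; have [f f_def] := No_ordD e c; exists f.
    by rewrite -No_ord_lt -f_def; apply: lt_le_trans bcd; rewrite No_ltD2r No_ord_lt.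
  by apply: IHb; rewrite // f_def.
have {}half2 v : v < omega_pow c -> No_ord (omega_pow b) ** No_ord v < No_ord (omega_pow d).
  rewrite No_mulC; apply: half => // e ec; have [f f_def] := No_ordD b e; exists f.
    by rewrite -No_ord_lt -f_def; apply: lt_le_trans bcd; rewrite No_ltD2l No_ord_lt.
  by rewrite No_mulC; apply: IHc; rewrite // f_def.
rewrite No_mul_cutE opp_side_No_ord; apply: cut_le_No_ord; split=> // z.
move=> [x [y [/simpler_No_ord[u ub ->] /simpler_No_ord[v vc ->] _ ->]]].
(* Dropping the subtracted product leaves two terms below omega^d, which is closed under the
   Hessenberg sum. *)
rewrite /mulopt; apply: (@le_lt_trans _ _
  (No_ord u ** No_ord (omega_pow c) + No_ord (omega_pow b) ** No_ord v)%R).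
  rewrite -(No_leD2r (No_ord u ** No_ord v)) subrK -{1}[(_ + _)%R]addr0 No_leD2l.
  by apply: No_mul_ge0; exact: No_ord_ge0.
have [e e_def] := No_ordM u (omega_pow c); have [f f_def] := No_ordM (omega_pow b) v.
rewrite e_def f_def; apply: nadd_closed_omega_pow; rewrite -No_ord_lt.
  by rewrite -e_def half1.
by rewrite -f_def half2.
Qed.

(** From x <= omega^b * n and y <= omega^c * m the product is at most m n times omega^d, d being the
    Hessenberg sum of b and c; and d < omega^psi by additive closure. *)
Lemma nmul_closed_omega_pow psi x y :
  x < omega_pow (omega_pow psi) -> y < omega_pow (omega_pow psi) ->
  No_ord x ** No_ord y < No_ord (omega_pow (omega_pow psi)).
Proof.
move=> /lt_omega_pow_mulrn[->|[b [n [bp xn]]]].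
  by rewrite No_mul0r No_ord_lt omega_pow_gt0.
move=> /lt_omega_pow_mulrn[->|[c [m [cp ym]]]].
  by rewrite No_mulr0 No_ord_lt omega_pow_gt0.
have [d d_def] := No_ordD b c.
have dp : d < omega_pow psi by rewrite -No_ord_lt -d_def nadd_closed_omega_pow.
apply: le_lt_trans (omega_pow_mulrn_lt (m * n) dp); rewrite mulrnA.
apply: le_trans (No_ler_M (No_ord_ge0 _) _ xn ym) _.
  by apply: No_mulrn_ge0; exact: No_ord_ge0.
by rewrite No_mulrnAl No_mulrnAr; do 2!apply: No_lerMn; apply: omega_pow_mul_le_No; rewrite d_def.
Qed.

(** * Initial convex subdomains *)

Lemma initial_ord (K : set No) a b : initial K -> K (No_ord b) -> a <= b -> K (No_ord a).
Proof.
move=> K_init Kb; rewrite le_eqVlt => /orP[/eqP->//|ab]; apply: K_init Kb _.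
by apply/simpler_No_ord; exists a.
Qed.

(** If y began with a + 1 signs +, so would x. The successor is required, as [No_ord a] is simpler
    than some numbers just below it. *)
Lemma simpler_lt_succ x y a : simpler y x -> x < No_ord a -> y < No_ord (On_succ a).
Proof.
move=> [_ yx] xa; rewrite ltNge; apply/negP => ay; move: xa; rewrite ltNge => /negP; apply.
apply/ltW/lt_No_ordP => c ca; have yc : y c = Some true.
  by apply: le_No_ord_sgn ay _; rewrite On_lt_succE.
by rewrite -yx yc.
Qed.

Lemma No_lt_oppl (x y : No) : ((- x)%R < y) = ((- y)%R < x).
Proof. by rewrite -(No_ltD2r x) addNr -(No_ltD2l (- y)%R) addr0 addKr. Qed.

(** Adding (a - x)(b - y) > 0 and (a + x)(b + y) > 0 gives 2 (a b + x y) > 0. *)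
Lemma No_mul_lower_bound (a b x y : No) :
  (- a)%R < x -> x < a -> (- b)%R < y -> y < b -> (- (a ** b))%R < x ** y.
Proof.
move=> ax xa by_ yb; have := No_ltD (mul_rect_lt xa yb) (mul_rect_lt ax by_).
rewrite !No_mulrN !No_mulNr opprK [(- _ - _)%R]addrC -opprD subrr [(a ** b + _)%R]addrC => xyab.
rewrite -(No_ltD2r (a ** b)) addNr ltNge; apply/negP => xyab0; move: xyab; rewrite ltNge => /negP; apply.
by rewrite -[leRHS]addr0; exact: No_leD.
Qed.

(** The closure hypotheses ask for upper bounds within [below h], so that ordinals and [OnAll] are
    treated alike. *)
Lemma bounded_part_subdomain (A : set No) (h : exOn) :
  initial A -> subdomain A -> below h On1 ->
  (forall a, below h a -> below h (On_succ a)) ->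
  (forall a b, below h a -> below h b ->
    exists2 c, below h c & (No_ord a + No_ord b)%R <= No_ord c) ->
  (forall a b, below h a -> below h b ->
    exists2 c, below h c & No_ord a ** No_ord b <= No_ord c) ->
  let K := bounded_part A h in [/\ initial K, subdomain_of K A & convex_in K A].
Proof.
move=> A_init [A1 AB AM] h1 hS hD hM K.
have opp_le (a c : On) : a <= c -> (- No_ord c)%No <= (- No_ord a)%No.
  by move=> ac; rewrite leNgt No_lt_opp2 -leNgt No_ord_le.
have boundE x y : K x -> K y -> exists a, [/\ below h a, (- No_ord a)%No < x,
    x < No_ord a, (- No_ord a)%No < y & y < No_ord a].
  move=> [_ [a [ha [ax xa]]]] [_ [b [hb [by_ yb]]]].
  wlog ab : a b x y ha hb ax xa by_ yb / a <= b => [wl|].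
    have [ab|/ltW ba] := leP a b; first exact: (wl a b).
    by have [c []] := wl b a y x hb ha by_ yb ax xa ba; exists c.
  exists b; split=> //; first exact: le_lt_trans (opp_le _ _ ab) ax.
  by apply: lt_le_trans xa _; rewrite No_ord_le.
split.
- move=> x y [Ax [a [ha [ax xa]]]] yx; split; first exact: A_init yx.
  exists (On_succ a); split; first exact: hS; split; last exact: simpler_lt_succ xa.
  rewrite No_lt_oppl -[(- y)%R]/(- y)%No No_opp_flip.
  apply: (@simpler_lt_succ (flip x)); first exact: flip_simpler.
  by rewrite -No_opp_flip; rewrite No_lt_oppl in ax.
- split=> [x []//|]; split.
  + split=> //; exists (On_succ On1); split; first exact: hS.
    split; last by rewrite No_ord_lt On_lt_succ.
    apply: (@le_lt_trans _ _ No0); last by rewrite No_ord_lt On_lt_succ.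
    by rewrite -(No_leD2r (No_ord (On_succ On1))) addNr [(_ + _)%R]add0r No_ord_ge0.
  + move=> x y Kx Ky; have [a [ha ax xa ay ya]] := boundE x y Kx Ky.
    split; first by apply: AB; [case: Kx|case: Ky].
    have [c hc ac] := hD a a ha ha; exists c; split=> //; split.
      rewrite No_lt_oppl; apply: lt_le_trans ac; rewrite No_addE_ring opprD opprK.
      by apply: No_ltD => //; rewrite -No_lt_oppl.
    apply: lt_le_trans ac; apply: No_ltD => //; by rewrite -No_lt_oppl.
  + move=> x y Kx Ky; have [a [ha ax xa ay ya]] := boundE x y Kx Ky.
    split; first by apply: AM; [case: Kx|case: Ky].
    have [c hc ac] := hM a a ha ha; exists c; split=> //; split.
      apply: le_lt_trans (No_mul_lower_bound ax xa ay ya).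
      by rewrite leNgt No_lt_opp2 -leNgt.
    (* The upper bound for x * y is the lower bound for (- x) * y. *)
    apply: lt_le_trans ac; rewrite -No_lt_opp2 -[(- (x ** y))%No]No_mulNr.
    by apply: No_mul_lower_bound => //; rewrite ?No_lt_opp2 // No_lt_oppl.
- move=> x y z Kx Ky Az xz zy; have [a [ha ax xa ay ya]] := boundE x y Kx Ky.
  split=> //; exists a; split=> //; split; first exact: lt_trans xz.
  exact: lt_trans ya.
Qed.

Lemma On_lt1_omega_pow2 psi : On1 < omega_pow (omega_pow psi).
Proof.
by apply: le_lt_trans (omega_pow_lt (omega_pow_gt0 psi)); rewrite On_succ_le omega_pow_gt0.
Qed.

Lemma below_segment (P : set On) : (forall a b, P b -> a <= b -> P a) -> exists h, P = below h.
Proof.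
move=> P_down; have [PT|/existsNP/On_min[a [Pa a_min]]] := pselect (forall a, P a).
  by exists OnAll; apply/seteqP; split.
exists (Ord a); apply/seteqP; split=> b /=.
  by move=> Pb; rewrite ltNge; apply/negP => /(P_down _ _ Pb).
by move=> ba; apply: contrapT => /a_min; rewrite leNgt ba.
Qed.

Lemma bounded_partE (A K : set No) (h : exOn) :
  initial K -> subdomain_of K A -> convex_in K A ->
  [set a | K (No_ord a)] = below h -> K = bounded_part A h.
Proof.
move=> K_init [KA [K1 KB _]] K_conv Kh.
have inK a : below h a <-> K (No_ord a) by rewrite -Kh.
have K0 : K 0%R by rewrite -(subrr No1); exact: KB.
have KN x : K x -> K (- x)%R by move=> Kx; rewrite -[(- x)%R]add0r; exact: KB.
have KD x y : K x -> K y -> K (x + y)%R by move=> Kx Ky; rewrite -[y]opprK; apply/KB/KN.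
have upper x : K x -> exists2 a, K (No_ord a) & x < No_ord a.
  (* [a] counts the leading signs + of x. [No_ord a] is x or simpler than x, so it is in K, and x <
     a + 1. *)
  move=> Kx; have [a [xa a_min]] : exists a, x a <> Some true /\
      forall b, x b <> Some true -> a <= b.
    by apply: (@On_min [set a | x a <> Some true]); exists (len x); rewrite /= (sgn_None x _).2.
  exists (On_succ a); last first.
    rewrite ltNge; apply/negP => /le_No_ord_sgn/(_ (On_lt_succ a)); exact: xa.
  rewrite No_ordS; apply: KD => //.
  have : No_prefix (No_ord a) x.
    move=> b; rewrite sgn_No_ord; case: ifP => // ba _; apply: contrapT => /nesym/a_min.
    by rewrite leNgt ba.
  by case/prefix_simpler => [->//|]; exact: K_init.
apply/seteqP; split=> x.
  move=> Kx; split; first exact: KA.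
  have [a Ka xa] := upper _ Kx; have [b Kb xb] := upper _ (KN _ Kx).
  (* The sum of the bounds for x and - x serves on both sides. *)
  have [c c_def] := No_ordD a b; exists c; split; first by apply/inK; rewrite -c_def; exact: KD.
  rewrite -c_def; split; last first.
    by apply: lt_le_trans xa _; rewrite -{1}[No_ord a]addr0 No_leD2l No_ord_ge0.
  rewrite No_lt_oppl; apply: lt_le_trans xb _.
  by rewrite -{1}[No_ord b]add0r No_leD2r No_ord_ge0.
case=> Ax [a [/inK Ka [ax xa]]]; exact: K_conv (KN _ Ka) Ka Ax ax xa.
Qed.

Theorem theorem5 (A : set No) (phi : exOn)
    (phi_neq0 : phi <> Ord On0)
    (A_initial : initial A)
    (A_subfield : subfield A)
    (A_arch : archimedean A (exOmega_pow phi))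
    (K : set No) :
  [/\ initial K, subdomain_of K A & convex_in K A] <->
  exists tau : exOn,
    [/\ tau <> Ord On0,
        mul_indecomposable (exOmega_pow tau),
        exOn_le (exOmega_pow tau) (exOmega_pow phi) &
        K = bounded_part A (exOmega_pow tau)].
Proof.
split=> [[K_init K_sub K_conv]|[tau [_ tau_mul _ ->]]]; last first.
  case: tau tau_mul => [a|] /= a_mul; apply: bounded_part_subdomain => //; try exact: A_subfield.1.
  - by case: a_mul => psi ->; exact: On_lt1_omega_pow2.
  - move=> b ba.
    have [c c_def] := No_ordD b On1; have bc : On_succ b <= c by rewrite -No_ord_le -c_def No_ordS.
    apply: le_lt_trans bc _; rewrite -No_ord_lt -c_def; apply: nadd_closed_omega_pow => //.
    by case: a_mul => psi ->; exact: On_lt1_omega_pow2.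
  - move=> b c ba ca; have [d d_def] := No_ordD b c; exists d; last by rewrite d_def.
    by rewrite /= -No_ord_lt -d_def nadd_closed_omega_pow.
  - move=> b c; case: a_mul => psi -> ba ca; have [d d_def] := No_ordM b c.
    by exists d; [rewrite /= -No_ord_lt -d_def nmul_closed_omega_pow|rewrite d_def].
  - by move=> b c _ _; have [d d_def] := No_ordD b c; exists d; rewrite ?d_def.
  - by move=> b c _ _; have [d d_def] := No_ordM b c; exists d; rewrite ?d_def.
have [|h Kh] := @below_segment [set a | K (No_ord a)].
  by move=> a b Kb ab; exact: initial_ord Kb ab.
have KE := bounded_partE K_init K_sub K_conv Kh.
have inK a : below h a <-> K (No_ord a) by rewrite -Kh.
have inA a : below (exOmega_pow phi) a <-> A (No_ord a) by rewrite -A_arch.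
have [KA [K1 KB KM]] := K_sub.
case: h Kh KE inK => [a|] Kh KE inK; last first.
  (* K, hence A, contains every ordinal, while for an ordinal phi the power omega^phi is not in
     A. *)
  exists OnAll; split=> //; case: phi A_arch inA {phi_neq0} => //= p _ inA.
  by have /inA := KA _ ((inK (omega_pow p)).1 I); rewrite ltxx.
have KD b c : b < a -> c < a -> On_add b c < a.
  move=> /inK Kb /inK Kc; apply/inK; have [e e_def] := No_ordD b c.
  apply: (@initial_ord _ _ e) => //; last by rewrite -No_ord_le -e_def On_add_le_No.
  (* The sum is written b - ((1 - 1) - c), as subdomains are closed under differences. *)
  rewrite -e_def -[No_ord c]opprK -[(- No_ord c)%R]add0r -(subrr No1).
  by apply: (KB) => //; apply: (KB) => //; exact: KB.
have KM' b c : b < a -> c < a -> On_mul b c < a.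
  move=> /inK Kb /inK Kc; apply/inK; have [e e_def] := No_ordM b c.
  apply: (@initial_ord _ _ e) => //; last by rewrite -No_ord_le -e_def On_mul_le_No.
  by rewrite -e_def; exact: KM.
have [|psi a_def] := mul_closed_omega_pow _ KD KM'; first exact/inK.
exists (Ord (omega_pow psi)); split.
- by case=> psi0; have := omega_pow_gt0 psi; rewrite psi0 ltxx.
- by exists psi.
(* If omega^phi < a, then omega^phi would be an ordinal of K, hence of A. *)
- rewrite /= -a_def; case: phi A_arch inA {phi_neq0} => //= p _ inA.
  by rewrite leNgt; apply/negP => /inK/KA/inA; rewrite ltxx.
- by rewrite /= -a_def.
Qed.
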